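(* Let $\mu$ be a probability measure on a set $\mathcal{X}$ and let $k:\mathcal{X}\times\mathcal{X}\to\mathbb{R}$ be a positive-definite kernel with real RKHS $\mathcal{H}$, such that $\kappa:=\sup_{x\in\mathcal{X}}\sqrt{k(x,x)}<\infty$ and $k$ admits a Mercer expansion $k(x,y)=\sum_{j=1}^\infty \sigma_j e_j(x)e_j(y)$ for all $x,y\in\mathcal{X}$, where $(e_j)_{j\ge1}$ is an orthonormal set in $L^2(\mu)$ and $\sigma_1\ge\sigma_2\ge\cdots\ge0$. Let $N,d$ be positive integers with $6(d+1)\le N$, let $x_1,\dots,x_N\sim\mu$ be independent, and set $n_d:=\lfloor N/(6(d+1))\rfloor$. Then, with probability at least $1-2^{-(d+1)}$, there exist weights $(w_i)_{i=1}^N\in\Delta_N$ such that the quadrature rule $Q_N(f)=\sum_{i=1}^N w_if(x_i)$ satisfies \[ \operatorname{wce}(Q_N;\mathcal{H},\mu)\le 2\sqrt{\sum_{j>d}\sigma_j}+\frac{4\kappa}{n_d}. \]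
   Context: $\Delta_N:=\{\bm w\in\mathbb{R}^N_{\ge0}:\sum_{i=1}^N w_i=1\}$. For a quadrature rule $Q_N(f)=\sum_i w_i f(x_i)$, the worst-case error is $\operatorname{wce}(Q_N;\mathcal{H},\mu):=\sup_{\|f\|_{\mathcal{H}}\le1}\bigl|\int f\,\mathrm{d}\mu-Q_N(f)\bigr|=\bigl\|m_\mu-\sum_{i}w_ik(x_i,\cdot)\bigr\|_{\mathcal{H}}$, where $m_\mu:=\int k(x,\cdot)\,\mathrm{d}\mu(x)\in\mathcal{H}$ is the kernel mean embedding. *)

(* Defs.v *)
From HB Require Import structures.
From mathcomp Require Import all_boot all_order all_algebra.
From mathcomp Require Import all_classical all_reals all_analysis.
Set Implicit Arguments. Unset Strict Implicit. Unset Printing Implicit Defensive.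
Import Order.TTheory GRing.Theory Num.Theory.
Local Open Scope classical_set_scope.
Local Open Scope ring_scope.

Definition pd_kernel (X : Type) (R : realType) (k : X -> X -> R) : Prop :=
  (forall x y, k x y = k y x) /\
  (forall (n : nat) (c : 'I_n -> R) (x : 'I_n -> X),
      0 <= \sum_(i < n) \sum_(j < n) c i * c j * k (x i) (x j)).

Definition is_RKHS (X : Type) (R : realType) (k : X -> X -> R)
    (H : set (X -> R)) (ip : (X -> R) -> (X -> R) -> R) : Prop :=
  H (fun _ => 0) /\
      (forall (a : R) f g, H f -> H g -> H (fun y => a * f y + g y)) /\
      (forall f g, H f -> H g -> ip f g = ip g f) /\
      (forall (a : R) f g h, H f -> H g -> H h ->
          ip (fun y => a * f y + g y) h = a * ip f h + ip g h) /\
      (forall f, H f -> 0 <= ip f f /\ (ip f f = 0 -> f = (fun _ => 0))) /\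
      (forall u : nat -> X -> R, (forall n, H (u n)) ->
         (forall e : R, 0 < e -> exists M, forall n m, (M <= n)%N -> (M <= m)%N ->
              ip (fun y => u n y - u m y) (fun y => u n y - u m y) < e) ->
         exists f, H f /\ (forall e : R, 0 < e -> exists M, forall n, (M <= n)%N ->
              ip (fun y => u n y - f y) (fun y => u n y - f y) < e)) /\
      (forall x, H (k x)) /\
      (forall f x, H f -> ip f (k x) = f x).

Definition simplex (R : realType) (N : nat) (w : 'I_N -> R) : Prop :=
  (forall i, 0 <= w i) /\ \sum_(i < N) w i = 1.

Definition wce d (X : measurableType d) (R : realType) (mu : {measure set X -> \bar R})
    (H : set (X -> R)) (ip : (X -> R) -> (X -> R) -> R)
    (N : nat) (w : 'I_N -> R) (xs : 'I_N -> X) : \bar R :=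
  ereal_sup ((fun f : X -> R =>
      `| (\int[mu]_x (f x)%:E) - (\sum_(i < N) w i * f (xs i))%:E |%E)
    @` [set f | H f /\ ip f f <= 1]).

Definition orthonormal_L2 d (X : measurableType d) (R : realType)
    (mu : {measure set X -> \bar R}) (e : nat -> X -> R) : Prop :=
  (forall j, measurable_fun setT (e j)) /\
  (forall i j, (\int[mu]_x (e i x * e j x)%:E = ((i == j)%:R)%:E)%E).

Definition mutually_independent d0 d (Omega : measurableType d0) (X : measurableType d)
    (R : realType) (P : probability Omega R) (N : nat) (Xs : 'I_N -> Omega -> X) : Prop :=
  forall A : 'I_N -> set X, (forall i, measurable (A i)) ->
    P (\bigcap_(i in [set: 'I_N]) (Xs i @^-1` A i)) = (\prod_(i < N) P (Xs i @^-1` A i))%E.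

(* Main.v *)
(** Let [phi_j = sqrt sigma_j e_j] and [rest x = sqrt (sum_(j >= d) phi_j(x)^2)].
The feature vectors [(phi_0, ..., phi_(d-1), rest)] lie in the ball of radius
[kappa] of R^D, with [D = d + 1], and the worst-case error of convex weights is
at most [2 E(rest) + eps] as soon as the weighted mean of the features is within
[eps] of their expectation; moreover [E(rest)^2 <= sum_(j >= d) sigma_j].

So it suffices that the expectation, translated to 0, is within [eps = 4 kappa / n]
of the convex hull of [N >= 6 D n] centred sample points [Y_i] of norm at most
[K = 2 kappa]. Otherwise the minimal norm point [p] of the hull satisfies
[<p, Y_i> >= |p|^2 > eps |p|] for all [i], and by Caratheodory it is already
the minimal norm point of the hull of some [D + 1] of the [Y_i]. For every set
[S] of [L = 3 D n] indices avoiding these, the direction of [p] is computed from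
the [Y_i] with [i] outside [S] and is independent of the [Y_i] with [i] in [S], each
of which falls in the corresponding half-space with probability at most
[n / (n + 1)]. Such [S] form a fraction at least [(2/5)^(D+1)] of all sets of
size [L], so by Markov's inequality the failure probability is at most
[(5/2)^(D+1) (n / (n + 1))^L <= (5/2)^(D+1) 2^(-3D) <= 2^(-D)]. Directions are
taken in a finite net, so that all events are measurable and conditioning is
elementary. *)

Require Import Defs.
From HB Require Import structures.
From mathcomp Require Import all_boot all_order all_algebra.
From mathcomp Require Import all_classical all_reals all_analysis.
From mathcomp Require Import measurable_realfun ring lra zify.
Import Order.TTheory GRing.Theory Num.Theory.
Import numFieldNormedType.Exports.
Local Open Scope classical_set_scope.
Local Open Scope ring_scope.
Set Implicit Arguments.
Unset Strict Implicit.
Unset Printing Implicit Defensive.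

(** * Minimal norm points of convex hulls *)

(** Induction on the sum: the new cross term [2 * (x * y * S)] is controlled by [S ^+ 2 <= A * B]
    and the inequality of arithmetic and geometric means. *)
Lemma cauchy_schwarz_sum (R : realType) (I : Type) (r : seq I) (P : pred I)
    (a b : I -> R) :
  (\sum_(i <- r | P i) a i * b i) ^+ 2 <=
  (\sum_(i <- r | P i) a i ^+ 2) * (\sum_(i <- r | P i) b i ^+ 2).
Proof.
suff [_ [_ ->//]] : 0 <= \sum_(i <- r | P i) a i ^+ 2 /\
  0 <= \sum_(i <- r | P i) b i ^+ 2 /\
  (\sum_(i <- r | P i) a i * b i) ^+ 2 <=
  (\sum_(i <- r | P i) a i ^+ 2) * (\sum_(i <- r | P i) b i ^+ 2).
elim/big_rec3: _ => [|i S B A Pi [A0 [B0 SAB]]].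
  by rewrite expr0n mulr0.
move: (a i) (b i) => x y {a b Pi i}.
split; first by rewrite addr_ge0 ?sqr_ge0.
split; first by rewrite addr_ge0 ?sqr_ge0.
suff : 2 * (x * y * S) <= x ^+ 2 * B + y ^+ 2 * A.
  move=> h; have -> : (x * y + S) ^+ 2 = x ^+ 2 * y ^+ 2 + 2 * (x * y * S) + S ^+ 2 by ring.
  by rewrite mulrDl !mulrDr; lra.
have RHS0 : 0 <= x ^+ 2 * B + y ^+ 2 * A.
  by apply: addr_ge0; apply: mulr_ge0 => //; exact: sqr_ge0.
rewrite (le_trans (ler_norm _))// -ler_sqr ?nnegrE// real_normK ?num_real//.
have -> : (2 * (x * y * S)) ^+ 2 = 4 * (x ^+ 2 * y ^+ 2) * S ^+ 2 by ring.
have : 4 * (x ^+ 2 * y ^+ 2) * S ^+ 2 <= 4 * (x ^+ 2 * y ^+ 2) * (A * B).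
  apply: ler_wpM2l => //; apply: mulr_ge0 => //.
  by apply: mulr_ge0; exact: sqr_ge0.
move/le_trans; apply.
have := sqr_ge0 (x ^+ 2 * B - y ^+ 2 * A); nra.
Qed.

Definition dot (R : realType) (D : nat) (u v : 'I_D -> R) : R :=
  \sum_(j < D) u j * v j.

Definition comb (R : realType) (N D : nat) (w : 'I_N -> R)
    (Y : 'I_N -> 'I_D -> R) : 'I_D -> R :=
  fun j => \sum_(i < N) w i * Y i j.

Section dot_theory.
Context {R : realType} {D : nat}.
Implicit Types u v : 'I_D -> R.

Lemma dotC u v : dot u v = dot v u.
Proof. by apply: eq_bigr => j _; rewrite mulrC. Qed.

Lemma dot_ge0 u : 0 <= dot u u.
Proof. by apply: sumr_ge0 => j _; rewrite -expr2 sqr_ge0. Qed.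

Lemma dot_linl (a b : R) u v w :
  dot (fun j => a * u j + b * v j) w = a * dot u w + b * dot v w.
Proof.
rewrite /dot !mulr_sumr -big_split/=; apply: eq_bigr => j _; ring.
Qed.

Lemma dot_linr (a b : R) u v w :
  dot w (fun j => a * u j + b * v j) = a * dot w u + b * dot w v.
Proof. by rewrite dotC dot_linl !(dotC _ w). Qed.

Lemma dot_cauchy u v : dot u v ^+ 2 <= dot u u * dot v v.
Proof.
have sq w : dot w w = \sum_(j < D) w j ^+ 2.
  by apply: eq_bigr => j _; rewrite expr2.
by rewrite !sq; exact: cauchy_schwarz_sum.
Qed.

Lemma dot_le u v (a b : R) : 0 <= a -> 0 <= b ->
  dot u u <= a ^+ 2 -> dot v v <= b ^+ 2 -> dot u v <= a * b.
Proof.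
move=> a0 b0 ua vb; rewrite (le_trans (ler_norm _))//.
rewrite -ler_sqr ?nnegrE ?mulr_ge0// real_normK ?num_real//.
by rewrite exprMn (le_trans (dot_cauchy _ _))// ler_pM ?dot_ge0.
Qed.

Lemma dot_comb (N : nat) (w : 'I_N -> R) (Y : 'I_N -> 'I_D -> R) u :
  dot u (comb w Y) = \sum_(i < N) w i * dot u (Y i).
Proof.
rewrite /dot /comb; under eq_bigr do rewrite mulr_sumr.
rewrite exchange_big/=; apply: eq_bigr => i _; rewrite mulr_sumr.
by apply: eq_bigr => j _; rewrite mulrCA.
Qed.

End dot_theory.

Lemma simplex_convex (R : realType) (N : nat) (w w' : 'I_N -> R) (t : R) :
  0 <= t <= 1 -> simplex w -> simplex w' ->
  simplex (fun i => (1 - t) * w i + t * w' i).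
Proof.
move=> /andP[t0 t1] [w0 w1] [w'0 w'1]; split.
  by move=> i; rewrite addr_ge0 ?mulr_ge0 ?subr_ge0.
by rewrite big_split/= -!mulr_sumr w1 w'1 !mulr1 subrK.
Qed.

Lemma simplex_vertex (R : realType) (N : nat) (i : 'I_N) :
  simplex (fun l => (l == i)%:R : R).
Proof.
split=> [l|]; first exact: ler0n.
rewrite (bigD1 i)//= eqxx big1 ?addr0// => l /negPf->//.
Qed.

Lemma comb_vertex (R : realType) (N D : nat) (i : 'I_N)
    (Y : 'I_N -> 'I_D -> R) : comb (fun l => (l == i)%:R) Y = Y i.
Proof.
apply: funext => j; rewrite /comb (bigD1 i)//= eqxx mul1r big1 ?addr0//.
by move=> l /negPf->; rewrite mul0r.
Qed.

Lemma continuous_sum (R : realType) (T : topologicalType) (n : nat) (f : 'I_n -> T -> R) :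
  (forall i, continuous (f i)) -> continuous (fun x => \sum_(i < n) f i x).
Proof.
move=> cf x; elim: n f cf => [|n IH] f cf.
  under eq_fun do rewrite big_ord0; exact: cvg_cst.
under eq_fun do rewrite big_ord_recr/=.
apply: continuousD; last exact: cf.
by apply: (IH (fun i => f (widen_ord (leqnSn n) i))) => i; exact: cf.
Qed.

(** The squared norm of [comb w Y] is continuous in [w], and the simplex is compact, being closed in
    a cube. *)
Lemma min_norm_point (R : realType) (N D : nat) (Y : 'I_N -> 'I_D -> R) :
  (0 < N)%N ->
  exists2 w, simplex w & forall w', simplex w' ->
    dot (comb w Y) (comb w Y) <= dot (comb w' Y) (comb w' Y).
Proof.
move=> N0; pose A := [set v : 'rV[R]_N | simplex (fun i => v ord0 i)].
pose F (v : 'rV[R]_N) := dot (comb (fun i => v ord0 i) Y) (comb (fun i => v ord0 i) Y).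
have cF : continuous F.
  apply: continuous_sum => j.
  have cj : continuous (fun v : 'rV[R]_N => comb (fun i => v ord0 i) Y j).
    apply: continuous_sum => i v; apply: continuousM; last exact: cst_continuous.
    exact: coord_continuous.
  by move=> v; apply: continuousM; exact: cj.
have cA : compact A.
  have -> : A = [set v : 'rV[R]_N | forall i, `[0, 1]%classic (v ord0 i)] `&`
     [set v | \sum_(i < N) v ord0 i = 1].
    apply/seteqP; split=> v.
      move=> [v0 v1]; split => //= i; rewrite in_itv/= v0/= -v1.
      by rewrite (bigD1 i)//= lerDl sumr_ge0.
    by move=> [/= v01 v1]; split=> // i; have := v01 i; rewrite in_itv/= => /andP[].
  apply: compact_closedI.
    by apply: (@rV_compact _ _ (fun=> `[0 : R, 1]%classic)) => i; exact: segment_compact.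
  apply: (@closed_comp _ _ (fun v : 'rV[R]_N => \sum_(i < N) v ord0 i) [set 1]).
    by move=> v _; apply: continuous_sum => i; exact: coord_continuous.
  exact: closed_eq.
have rowE (v : 'I_N -> R) : (fun i => (\row_l v l) ord0 i) = v.
  by apply: funext => i; rewrite mxE.
have [c Ac cmin] : exists2 c, A c & forall t, A t -> F c <= F t.
  have [||c] := @compact_EVT_min _ _ F A _ cA.
  - exists (\row_l (l == Ordinal N0)%:R).
    by rewrite /A/= rowE; exact: simplex_vertex.
  - exact: continuous_subspaceT.
  - rewrite inE => cA' cm; exists c => // t At; apply: cm => //; exact: mem_set.
exists (fun i => c ord0 i) => // w' sw'.
by rewrite -(rowE w'); apply: cmin; rewrite /A/= rowE.
Qed.

(** More than [D.+1] vectors [(Y i, 1)] of length [D.+1] are linearly dependent. The entry 1 makes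
    the coefficients sum to 0, so a nonzero dependence has a positive coefficient. *)
Lemma affine_dependence (R : realType) (N D : nat) (Y : 'I_N -> 'I_D -> R)
    (B : {set 'I_N}) : (D.+1 < #|B|)%N ->
  exists l : 'I_N -> R, [/\ forall i, i \notin B -> l i = 0,
    exists i, 0 < l i, \sum_(i < N) l i = 0 &
    forall j, \sum_(i < N) l i * Y i j = 0].
Proof.
move=> DB.
pose A : 'M[R]_(#|B|, D.+1) := \matrix_(b, j)
  (if unlift ord_max j is Some j' then Y (enum_val b) j' else 1).
have [v vN0 vA] : exists2 v : 'rV_#|B|, v != 0 & v *m A = 0.
  have : kermx A != 0.
    rewrite kermx_eq0 /row_free neq_ltn (leq_ltn_trans (rank_leq_col A))//.
  by move/rowV0Pn => [v /sub_kermxP vA vN0]; exists v.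
pose l i := \sum_b v ord0 b * (enum_val b == i)%:R.
have lsum (f : 'I_N -> R) : \sum_(i < N) l i * f i = \sum_b v ord0 b * f (enum_val b).
  rewrite /l; under eq_bigr do rewrite mulr_suml.
  rewrite exchange_big/=; apply: eq_bigr => b _.
  rewrite (bigD1 (enum_val b))//= eqxx mulr1 big1 ?addr0// => i /negPf ib.
  by rewrite eq_sym ib mulr0 mul0r.
have l1 : \sum_(i < N) l i = 0.
  under eq_bigr do rewrite -[l _]mulr1.
  rewrite lsum; have /matrixP/(_ ord0 ord_max) := vA.
  by rewrite !mxE; under eq_bigr do rewrite mxE unlift_none.
have lb b : l (enum_val b) = v ord0 b.
  rewrite /l (bigD1 b)//= eqxx mulr1 big1 ?addr0// => b' b'b.
  by rewrite (inj_eq enum_val_inj) (negPf b'b) mulr0.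
exists l; split => //.
- move=> i iB; rewrite /l big1// => b _.
  case: eqP => [bi|]; last by rewrite mulr0.
  by move: iB; rewrite -bi enum_valP.
- apply: contrapT => /forallNP npos.
  have l0 i : l i <= 0 by rewrite leNgt; apply/negP/npos.
  have l00 i : l i = 0.
    apply/eqP; move: l1 => /eqP; rewrite -oppr_eq0 -sumrN psumr_eq0.
      by move=> /allP/(_ i); rewrite mem_index_enum oppr_eq0; exact.
    by move=> ? _; rewrite oppr_ge0.
  by move/eqP: vN0; apply; apply/rowP => b; rewrite -lb l00 mxE.
- move=> j; rewrite (lsum (fun i => Y i j)).
  have /matrixP/(_ ord0 (lift ord_max j)) := vA.
  by rewrite !mxE; under eq_bigr do rewrite mxE liftK.
Qed.

Definition wsupp (R : realType) (N : nat) (w : 'I_N -> R) : {set 'I_N} :=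
  [set i | w i != 0]%SET.

(** Strong induction on the support: moving along an affine dependence until a first weight reaches
    0 keeps the combination and removes an index. *)
Lemma caratheodory (R : realType) (N D : nat) (Y : 'I_N -> 'I_D -> R)
    (w : 'I_N -> R) : simplex w ->
  exists w', [/\ simplex w', comb w' Y = comb w Y &
    (#|wsupp w'| <= D.+1)%N].
Proof.
have [m] := ubnP #|wsupp w|; elim: m w => // m IH w wm sw.
have [wD|Dw] := leqP #|wsupp w| D.+1; first by exists w.
have [l [lB [i0 li0] l1 lY]] := affine_dependence Y Dw.
have [w0 w1] := sw.
(* Ratio test: [w i1 / l i1] is the largest step that keeps all weights nonnegative. *)
pose i1 := [arg min_(i < i0 | 0 < l i) (w i / l i)]%O.
have [li1 i1min] : 0 < l i1 /\ forall i, 0 < l i -> w i1 / l i1 <= w i / l i.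
  by rewrite /i1; case: arg_minP.
pose t := w i1 / l i1.
have t0 : 0 <= t by rewrite divr_ge0// ltW.
pose w2 i := w i - t * l i.
have sw2 : simplex w2.
  split=> [i|]; last by rewrite sumrB -mulr_sumr l1 mulr0 subr0.
  rewrite subr_ge0; have [li|li] := ltP 0 (l i).
    by rewrite -ler_pdivlMr// i1min.
  by rewrite (le_trans _ (w0 i))// mulr_ge0_le0.
have w2Y : comb w2 Y = comb w Y.
  apply: funext => j; rewrite /comb /w2; under eq_bigr do rewrite mulrBl -mulrA.
  by rewrite sumrB -mulr_sumr lY mulr0 subr0.
have [|w' [sw' w'Y w'D]] := IH w2 _ sw2; last by exists w'; rewrite w'Y w2Y.
rewrite -ltnS (leq_trans _ wm)// ltnS; apply: proper_card; apply/properP; split.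
  apply/fintype.subsetP => i; rewrite !inE; apply: contraNN => /eqP wi.
  by rewrite /w2 wi lB ?inE ?wi ?eqxx// mulr0 subr0.
exists i1; rewrite inE.
  apply: contraTneq li1 => wi; rewrite lB ?ltxx// inE wi eqxx//.
by rewrite negbK /w2 /t divfK ?subrr// gt_eqF.
Qed.

(* The obstruction to being within distance [eps] of the hull is the minimal
   norm point, which is carried by at most [D.+1] of the [Y i]. *)
Lemma separating_point (R : realType) (N D : nat) (Y : 'I_N -> 'I_D -> R)
    (eps : R) : (0 < N)%N -> 0 <= eps ->
  (forall w, simplex w -> eps ^+ 2 < dot (comb w Y) (comb w Y)) ->
  exists (w : 'I_N -> R) (B : {set 'I_N}) (rho : R),
    [/\ simplex w, (#|B| <= D.+1)%N, forall i, i \notin B -> w i = 0, eps < rho &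
     dot (comb w Y) (comb w Y) = rho ^+ 2 /\
     forall i, rho ^+ 2 <= dot (comb w Y) (Y i)].
Proof.
move=> N0 eps0 far; have [w0 sw0 w0min] := min_norm_point Y N0.
have [w [sw wY wB]] := caratheodory Y sw0.
exists w, (wsupp w), (Num.sqrt (dot (comb w Y) (comb w Y))).
have rhoE : Num.sqrt (dot (comb w Y) (comb w Y)) ^+ 2 = dot (comb w Y) (comb w Y).
  by rewrite sqr_sqrtr// dot_ge0.
split=> //.
- by move=> i; rewrite inE negbK => /eqP.
- by rewrite -ltr_sqr ?nnegrE ?sqrtr_ge0// rhoE far.
split=> // i; rewrite rhoE leNgt; apply/negP => lti.
pose p := comb w Y; rewrite -/p in lti *.
pose q j := Y i j - p j.
have dq : dot p q = dot p (Y i) - dot p p.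
  by have := dot_linr 1 (-1) (Y i) p p; rewrite !mul1r mulN1r => <-;
     congr dot; apply: funext => j; rewrite /q mul1r mulN1r.
(* Minimality of [|p|^2] along the segment of points [p + t q] from [p] to [Y i]. *)
have key t : 0 <= t <= 1 -> 0 <= 2 * t * dot p q + t ^+ 2 * dot q q.
  move=> t01; have := w0min _ (simplex_convex t01 sw (simplex_vertex R i)).
  have -> : comb (fun l => (1 - t) * w l + t * (l == i)%:R) Y =
            fun j => 1 * p j + t * q j.
    apply: funext => j; rewrite /q -(comb_vertex i Y) /p /comb.
    rewrite mul1r mulrBr !mulr_sumr addrCA -sumrB -big_split/=.
    by apply: eq_bigr => l _; ring.
  rewrite -wY -/p dot_linl !dot_linr (dotC q p); nra.
have qq0 := dot_ge0 q.
have dpq : dot p q < 0 by rewrite dq subr_lt0.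
(* As [<p, q> < 0], the quadratic is negative at [t = 1] or at its minimiser [- <p, q> / <q, q>],
   whichever is in range. *)
have [qs|qs] := leP (dot q q) (- dot p q).
  by have := key 1; rewrite lexx ler01 => /(_ isT); nra.
have qp : 0 < dot q q by rewrite (lt_trans _ qs)// oppr_gt0.
have /key : 0 <= - dot p q / dot q q <= 1.
  by rewrite divr_ge0 ?oppr_ge0 ?(ltW dpq)//= ler_pdivrMr// mul1r ltW.
have -> : 2 * (- dot p q / dot q q) * dot p q + (- dot p q / dot q q) ^+ 2 * dot q q
  = - (dot p q ^+ 2 / dot q q) by field; rewrite gt_eqF.
rewrite oppr_ge0 leNgt divr_gt0// exprn_even_gt0//= lt_eqF//.
Qed.

(** * Finite nets and nearly optimal directions *)

(** A grid of mesh [1 / m], with coordinates rounded towards 0 so that rounding never leaves the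
    ball. *)
Lemma unit_ball_net (R : realType) (D : nat) (delta : R) : 0 < delta ->
  exists (M : nat) (r : 'I_M -> 'I_D -> R), (0 < M)%N /\
    (forall g, dot (r g) (r g) <= 1) /\
    forall u, dot u u <= 1 ->
      exists g, dot (fun j => r g j - u j) (fun j => r g j - u j) <= delta ^+ 2.
Proof.
(* With [m >= D / delta^2] the squared rounding error is at most [D / m^2 <= D / m <= delta^2]. *)
move=> delta0; pose m := (Num.truncn (D%:R / delta ^+ 2)).+1.
have m0 : 0 < m%:R :> R by rewrite ltr0n.
have Dm : D%:R * (m%:R^-1) ^+ 2 <= delta ^+ 2.
  have h : D%:R / delta ^+ 2 <= m%:R :> R.
    by apply/ltW; rewrite /m truncnS_gt.
  rewrite ler_pdivrMr ?exprn_gt0// in h.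
  have h1 : (m%:R : R)^-1 <= 1 by rewrite invf_le1// ler1n.
  rewrite expr2 mulrA; apply: (@le_trans _ _ (D%:R / m%:R)).
    by rewrite ler_piMr// divr_ge0.
  by rewrite ler_pdivrMr// mulrC.
pose G := {ffun 'I_D -> 'I_m.+1 * bool}.
pose r0 (g : G) j : R := (-1) ^+ (g j).2 * ((g j).1%:R / m%:R).
(* Grid points outside the ball are replaced by 0, so that every direction has norm at most 1. *)
pose r (g : 'I_#|G|) j := if dot (r0 (enum_val g)) (r0 (enum_val g)) <= 1
  then r0 (enum_val g) j else 0.
exists #|G|, r; split.
  by apply/card_gt0P; exists (finfun (fun=> (ord0, false))).
split.
  move=> g; rewrite /r; case: (boolP (dot (r0 (enum_val g)) (r0 (enum_val g)) <= 1)) => h;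
    last by rewrite /dot big1 ?ler01// => j _; rewrite mulr0.
  exact: h.
move=> u u1.
have uj j : `|u j| <= 1.
  rewrite -(@ler_sqr R) ?nnegrE// real_normK ?num_real// expr1n (le_trans _ u1)//.
  by rewrite /dot (bigD1 j)//= -expr2 lerDl sumr_ge0// => l _; rewrite -expr2 sqr_ge0.
have tr j : (Num.truncn (m%:R * `|u j|))%:R <= m%:R * `|u j| <
            (Num.truncn (m%:R * `|u j|)).+1%:R.
  by apply: truncn_itv; rewrite mulr_ge0// ltW.
have trm j : (Num.truncn (m%:R * `|u j|) < m.+1)%N.
  rewrite ltnS -(ler_nat R); have /andP[h _] := tr j.
  by rewrite (le_trans h)// ler_piMr// ltW.
pose g0 : G := [ffun j => (Ordinal (trm j), u j < 0)].
have r0E j : exists x, [/\ r0 g0 j = (-1) ^+ (u j < 0)%R * x, 0 <= x, x <= `|u j| &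
    `|u j| - x <= m%:R^-1].
  exists ((Num.truncn (m%:R * `|u j|))%:R / m%:R); have /andP[h1 h2] := tr j.
  split.
  - by rewrite /r0 ffunE.
  - by apply: divr_ge0; exact: ler0n.
  - by rewrite ler_pdivrMr// [leRHS]mulrC.
  - rewrite lerBlDr -[X in X + _]mul1r -mulrDl ler_pdivlMr// [leLHS]mulrC.
    by rewrite nat1r ltW.
have uE j : u j = (-1) ^+ (u j < 0)%R * `|u j| by exact: numEsign.
have r01 : dot (r0 g0) (r0 g0) <= 1.
  apply: le_trans u1; apply: ler_sum => j _; have [x [-> x0 xu _]] := r0E j.
  rewrite -!expr2 exprMn sqrr_sign mul1r -(real_normK (num_real (u j))).
  by rewrite ler_sqr ?nnegrE.
exists (enum_rank g0).
have -> : r (enum_rank g0) = r0 g0.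
  by apply: funext => j; rewrite /r enum_rankK r01.
apply: (le_trans _ Dm).
have -> : D%:R * m%:R^-1 ^+ 2 = \sum_(j < D) m%:R^-1 ^+ 2 :> R.
  by rewrite sumr_const card_ord mulr_natl.
apply: ler_sum => j _; have [x [-> x0 xu xm]] := r0E j.
rewrite -expr2 {2}uE -mulrBr exprMn sqrr_sign mul1r -sqrrN opprB.
by rewrite ler_sqr ?nnegrE ?subr_ge0// invr_ge0 ltW.
Qed.

(* [g] minimises the largest inner product with the points outside [S]. *)
Definition optimal (R : realType) (N D M : nat) (r : 'I_M -> 'I_D -> R)
    (S : {set 'I_N}) (Y : 'I_N -> 'I_D -> R) (g : 'I_M) : Prop :=
  forall g' i, i \notin S ->
    exists2 i', i' \notin S & dot (r g) (Y i) <= dot (r g') (Y i').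

(** A minimum of maxima over finite sets; if [S] contains every index, the condition is vacuous. *)
Lemma exists_optimal (R : realType) (N D M : nat) (r : 'I_M -> 'I_D -> R)
    (S : {set 'I_N}) (Y : 'I_N -> 'I_D -> R) :
  (0 < M)%N -> exists g, optimal r S Y g.
Proof.
move=> M0; have [[i0 i0S]|nS] := pselect (exists i, i \notin S); last first.
  by exists (Ordinal M0) => g' i iS; exfalso; apply: nS; exists i.
pose wi g := [arg max_(i > i0 | i \notin S) dot (r g) (Y i)]%O.
have wiP g : wi g \notin S /\ forall i, i \notin S -> dot (r g) (Y i) <= dot (r g) (Y (wi g)).
  by rewrite /wi; case: arg_maxP.
pose g0 := [arg min_(g < Ordinal M0) dot (r g) (Y (wi g))]%O.
have g0P g : dot (r g0) (Y (wi g0)) <= dot (r g) (Y (wi g)).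
  by rewrite /g0; case: arg_minP => // g1 _; apply.
exists g0 => g' i iS; exists (wi g'); first by have [] := wiP g'.
by apply: le_trans (g0P g'); have [_] := wiP g0; apply.
Qed.

(* By strict convexity of the ball a direction that is nearly optimal for a
   sample containing [B] is close to the optimal one, hence it also separates the
   points of [S], on which it does not depend. *)
Lemma optimal_separates (R : realType) (N D M : nat) (r : 'I_M -> 'I_D -> R)
    (delta K eps rho : R) (S B : {set 'I_N}) (Y : 'I_N -> 'I_D -> R)
    (w : 'I_N -> R) (g : 'I_M) :
  0 < K -> 0 < eps -> 0 < delta -> 8 * K ^+ 3 * delta <= eps ^+ 3 ->
  (forall g, dot (r g) (r g) <= 1) ->
  (forall u, dot u u <= 1 ->
      exists g, dot (fun j => r g j - u j) (fun j => r g j - u j) <= delta ^+ 2) ->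
  (forall i, dot (Y i) (Y i) <= K ^+ 2) ->
  simplex w -> (forall i, i \notin B -> w i = 0) -> eps < rho ->
  dot (comb w Y) (comb w Y) = rho ^+ 2 ->
  (forall i, rho ^+ 2 <= dot (comb w Y) (Y i)) ->
  (forall i, i \in S -> i \notin B) -> optimal r S Y g ->
  forall i, dot (r g) (Y i) < - (eps / 2).
Proof.
move=> K0 eps0 delta0 hdelta r1 net YK [w0 w1] wB erho pp pY SB og i.
set p := comb w Y in pp pY.
have rho0 : 0 < rho by rewrite (lt_trans eps0).
(* The exact unit direction: every point has inner product at most [- rho] with it, and the net
   comes within [delta] of it. *)
pose u j := - rho^-1 * p j.
have du v : dot v u = - rho^-1 * dot v p.
  rewrite -(addr0 (_ * dot v p)) -(mul0r (dot v p)) -dot_linr.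
  by congr dot; apply: funext => j; rewrite mul0r addr0.
have uu : dot u u = 1.
  by rewrite du dotC du pp; field; rewrite gt_eqF.
have uY l : dot u (Y l) <= - rho.
  by rewrite dotC du mulNr lerN2 dotC ler_pdivlMl//; exact: pY.
have [|g' g'u] := net u; first by rewrite uu.
have dB (a b c : 'I_D -> R) : dot (fun j => a j - b j) c = dot a c - dot b c.
  have := dot_linl 1 (-1) a b c; rewrite mul1r mulN1r => <-.
  by congr dot; apply: funext => j; rewrite mul1r mulN1r.
have g'Y l : dot (r g') (Y l) <= - rho + delta * K.
  have := dot_le (ltW delta0) (ltW K0) g'u (YK l).
  by rewrite dB; have := uY l; lra.
have gY l : l \notin S -> dot (r g) (Y l) <= - rho + delta * K.
  by move=> lS; have [i' _] := og g' l lS => /le_trans; apply.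
(* [p] is a convex combination of points with index in [B], all outside [S], so their bound passes
   to [p]. *)
have gp : dot (r g) p <= - rho + delta * K.
  rewrite /p dot_comb -[leRHS]mul1r -w1 mulr_suml; apply: ler_sum => l _.
  have [lB|lB] := boolP (l \in B); last by rewrite wB// !mul0r.
  apply: ler_wpM2l => //; apply: gY.
  by apply: contraTN lB; exact: SB.
(* [|r g - u|^2 <= 2 - 2 <r g, u>] and [<r g, u> >= 1 - delta * K / eps]. The condition on [delta]
   makes the distance at most [eps / (2 * K)], which costs at most [eps / 2] against vectors of norm
   at most [K]. *)
have gu : dot (fun j => r g j - u j) (fun j => r g j - u j) <= (eps / (2 * K)) ^+ 2.
  rewrite dB (dotC (r g)) (dotC u) !dB uu (dotC u) du.
  have : rho^-1 * dot (r g) p <= -1 + delta * K / eps.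
    rewrite -ler_pdivlMl ?invr_gt0// invrK (le_trans gp)// mulrDr mulrN1 lerD2l.
    rewrite mulrA ler_pdivlMr// mulrC ler_wpM2r ?mulr_ge0 ?ltW//.
  have : 2 * (delta * K / eps) <= (eps / (2 * K)) ^+ 2.
    have -> : (eps / (2 * K)) ^+ 2 = eps ^+ 3 / (4 * K ^+ 2 * eps).
      by field; rewrite !gt_eqF.
    rewrite ler_pdivlMr ?mulr_gt0 ?exprn_gt0//.
    have -> : 2 * (delta * K / eps) * (4 * K ^+ 2 * eps) = 8 * K ^+ 3 * delta.
      by field; rewrite gt_eqF.
    by [].
  have := r1 g; lra.
have eK0 : 0 <= eps / (2 * K) by rewrite divr_ge0 ?mulr_ge0 ?ltW.
have := dot_le eK0 (ltW K0) gu (YK i).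
have -> : eps / (2 * K) * K = eps / 2 by field; rewrite gt_eqF.
rewrite dB; have := uY i; lra.
Qed.

(** * Counting the index sets that avoid the witnesses *)

Lemma card_disjoint_draws (N L : nat) (B : {set 'I_N}) (b : nat) : (#|B| <= b)%N ->
  ('C(N - b, L) <= #|[set S : {set 'I_N} | S \subset ~: B & #|S| == L]%SET|)%N.
Proof.
move=> Bb; rewrite cards_draws cardsCs finset.setCK card_ord.
by rewrite leq_bin2l// leq_sub2l.
Qed.

(** Passing from [b] to [b.+1] multiplies ['C(N - b, L)] by [(N - b - L) / (N - b)], which is at
    least [2 / 5] when [2 * L <= N] and [3 * b <= L]. *)
Lemma binomial_ratio (N L b : nat) : (2 * L <= N)%N -> (3 * b.-1 <= L)%N ->
  (2 ^ b * 'C(N, L) <= 5 ^ b * 'C(N - b, L))%N.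
Proof.
move=> LN; elim: b => [|b IH] bL; first by rewrite subn0.
have {}IH := IH ltac:(lia).
have [L0|L0] := posnP L; first by rewrite L0 !bin0 !muln1 leq_exp2r.
have := mul_bin_down (N - b) L; rewrite -subnS => h.
have : (2 * 'C(N - b, L) <= 5 * 'C(N - b.+1, L))%N.
  rewrite -(@leq_pmul2l (N - b)); last by move: bL => /=; lia.
  rewrite [leqRHS]mulnCA h; move: bL => /=; nia.
rewrite !expnS; move: (2 ^ b)%N (5 ^ b)%N IH => x y; nia.
Qed.

(** * Tests on an independent part of the sample *)

Lemma measurable_dot (R : realType) (d : measure_display) (T : measurableType d)
    (D : nat) (u : 'I_D -> R) (Y : T -> 'I_D -> R) :
  (forall j, measurable_fun setT (Y^~ j)) ->
  measurable_fun setT (fun x => dot u (Y x)).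
Proof.
move=> mY; apply: measurable_sum => j.
by apply: measurable_funM => //; exact: measurable_cst.
Qed.

(** Finitely many comparisons of inner products. Only points outside [S] enter, so the result
    applies to the sigma-algebra that these generate. *)
Lemma measurable_optimal (R : realType) (d : measure_display) (T : measurableType d)
    (N D M : nat) (r : 'I_M -> 'I_D -> R) (S : {set 'I_N})
    (Y : T -> 'I_N -> 'I_D -> R) (g : 'I_M) :
  (forall i j, i \notin S -> measurable_fun setT (fun x => Y x i j)) ->
  measurable [set x | optimal r S (Y x) g].
Proof.
move=> mY.
rewrite (_ : [set x | _] = \bigcap_(g' in [set: 'I_M])
    \bigcap_(i in [set i | i \notin S]) \bigcup_(i' in [set i | i \notin S])
    [set x | dot (r g) (Y x i) <= dot (r g') (Y x i')]); last first.
  apply/seteqP; split=> x /=.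
    by move=> ox g' _ i /= /(ox g')[i' ? ?]; exists i'.
  by move=> ox g' i iS; have [i' ? ?] := ox g' I i iS; exists i'.
apply: fin_bigcap_measurable; first exact: finite_finset.
move=> g' _; apply: fin_bigcap_measurable; first exact: finite_finset.
move=> i /= iS; apply: fin_bigcup_measurable; first exact: finite_finset.
move=> i' /= i'S; rewrite -[X in measurable X]setTI.
apply: (measurable_fun_ler _ _ measurableT (Y := [set true])) => //.
- by apply: measurable_dot => j; exact: mY.
- by apply: measurable_dot => j; exact: mY.
Qed.

Section independent_test.
Context {R : realType} {d0 d1 : measure_display} {Omega : measurableType d0}
  {X : measurableType d1} (P : probability Omega R) (N : nat)
  (Xs : 'I_N -> Omega -> X).
Hypothesis mXs : forall i, measurable_fun setT (Xs i).
Hypothesis indXs : mutually_independent P Xs.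

(** A pi-system generating the sigma-algebra of the sample points with index outside [S]. *)
Definition cylinders (S : {set 'I_N}) : set (set Omega) :=
  [set A | exists2 B : 'I_N -> set X,
     (forall i, measurable (B i) /\ (i \in S -> B i = setT)) &
     A = \bigcap_(i in [set: 'I_N]) (Xs i @^-1` B i)].

Lemma measurable_preimage_Xs i (B : set X) : measurable B -> measurable (Xs i @^-1` B).
Proof. by move=> mB; rewrite -[X in measurable X]setTI; exact: mXs. Qed.

Lemma measurable_capXs (I : set 'I_N) (B : 'I_N -> set X) :
  (forall i, measurable (B i)) -> measurable (\bigcap_(i in I) (Xs i @^-1` B i)).
Proof.
move=> mB; apply: fin_bigcap_measurable; first exact: finite_finset.
by move=> i _; exact: measurable_preimage_Xs.
Qed.

Lemma cylinders_setI S : setI_closed (cylinders S).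
Proof.
move=> _ _ [B hB ->] [C hC ->]; exists (fun i => B i `&` C i).
  move=> i; have [mB BT] := hB i; have [mC CT] := hC i.
  by split; [exact: measurableI|move=> iS; rewrite BT// CT// setTI].
by rewrite -bigcapI.
Qed.

(** Dynkin's argument: the events independent of [Q] form a lambda-system, which contains the
    cylinders by mutual independence. *)
Lemma independent_cylinder S (A : set Omega) (C : set X) :
  <<s cylinders S >> A -> measurable C ->
  P (A `&` \bigcap_(i in [set i | i \in S]) (Xs i @^-1` C)) =
  (P A * \prod_(i in S) P (Xs i @^-1` C))%E.
Proof.
move=> sA mC; set Q := \bigcap_(i in _) _.
have mQ : measurable Q by exact: measurable_capXs.
have PQ : P Q = (\prod_(i in S) P (Xs i @^-1` C))%E.
  (* Padding with the whole space extends the intersection to all indices, where independence is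
     stated. *)
  pose B i := if i \in S then C else setT.
  have -> : Q = \bigcap_(i in [set: 'I_N]) (Xs i @^-1` B i).
    apply/seteqP; split=> x Qx i /=; rewrite /B.
      by case: ifPn => // iS _; exact: Qx.
    by move=> iS; have := Qx i I; rewrite /B/= iS.
  rewrite indXs; last by move=> i; rewrite /B; case: ifPn.
  rewrite [RHS]big_mkcond/=; apply: eq_bigr => i _; rewrite /B; case: ifPn => // _.
  by rewrite preimage_setT probability_setT.
suff : <<s cylinders S >> `<=` [set A | measurable A /\ P (A `&` Q) = (P A * P Q)%E].
  by move=> /(_ _ sA)[_ ->]; rewrite PQ.
apply: lambda_system_subset => //; first exact: cylinders_setI.
- apply/dynkin_lambda_system; split.
  + by split => //; rewrite setTI probability_setT mul1e.
  + move=> B [mB PB]; split; first exact: measurableC.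
    rewrite setIC -setDE measureD//=; last by rewrite ltey_eq fin_num_measure.
    rewrite setIC probability_setC// [X in (X - _)%E](_ : _ = 1 * P Q)%E ?mul1e//.
    have fB : P B \is a fin_num by exact: fin_num_measure.
    have fQ : P Q \is a fin_num by exact: fin_num_measure.
    transitivity ((1 - P B) * P Q)%E => //; rewrite muleBl ?mul1e//.
    by rewrite [in LHS]PB.
  + move=> F tF hF; split; first by apply: bigcup_measurable => k _; have [] := hF k.
    rewrite setI_bigcupl !measure_semi_bigcup//.
    * rewrite -(fineK (fin_num_measure P Q mQ)) muleC -nneseriesZl//.
      apply: eq_eseriesr => n _; rewrite fineK ?fin_num_measure// muleC.
      exact: (hF n).2.
    * by move=> n; have [] := hF n.
    * by apply: bigcup_measurable => k _; have [] := hF k.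
    * by move=> n; apply: measurableI => //; have [] := hF n.
    * exact: trivIset_setIr.
    * by apply: bigcup_measurable => k _; apply: measurableI => //; have [] := hF k.
- move=> _ [B hB ->]; split.
    by apply: measurable_capXs => i; have [] := hB i.
  rewrite PQ (indXs (fun i => (hB i).1)).
  (* The cylinder imposes nothing on [S], so both constraints merge into one family. *)
  pose B' i := if i \in S then C else B i.
  have -> : \bigcap_(i in [set: 'I_N]) (Xs i @^-1` B i) `&` Q =
            \bigcap_(i in [set: 'I_N]) (Xs i @^-1` B' i).
    apply/seteqP; split=> [x [Bx Qx] i _|x Bx]; rewrite /B'/=.
      by case: ifPn => iS; [exact: Qx|exact: Bx].
    split=> i /=.
      have := Bx i I; rewrite /B'/=; case: ifPn => // iS _ _.
      by have [_ ->] := hB i.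
    by move=> iS; have := Bx i I; rewrite /B'/= iS.
  rewrite indXs; last by move=> i; rewrite /B'; case: ifPn => // _; have [] := hB i.
  rewrite [in RHS](bigID (mem S))/= [X in (X * _ * _)%E]big1 ?mul1e; last first.
    by move=> i iS; have [_ ->//] := hB i; rewrite preimage_setT probability_setT.
  rewrite (bigID (mem S))/= muleC; congr (_ * _)%E.
    by apply: eq_bigr => i /negPf iS; rewrite /B' iS.
  by apply: eq_bigr => i iS; rewrite /B' iS.
Qed.

(* [G] is the event that the first direction that is optimal for the points
   outside [S] passes the test on [S]; given that direction, the tests are
   independent. *)
Lemma selected_direction_bound (mu : probability X R) (D M : nat)
    (r : 'I_M.+1 -> 'I_D -> R) (f : X -> 'I_D -> R) (s q : R) (S : {set 'I_N}) :
  (forall i (A : set X), measurable A -> P (Xs i @^-1` A) = mu A) ->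
  (forall j, measurable_fun setT (f^~ j)) ->
  (forall g, (mu [set x | (dot (r g) (f x) < s)%R] <= q%:E)%E) ->
  exists G : set Omega, [/\ measurable G, (P G <= (q ^+ #|S|)%:E)%E &
    forall omega,
      (forall g, optimal r S (fun i => f (Xs i omega)) g ->
        forall i, dot (r g) (f (Xs i omega)) < s) ->
      G omega].
Proof.
move=> PXs mf hq.
have q0 : 0 <= q by rewrite -lee_fin (le_trans _ (hq ord0)).
pose C g := [set x | (dot (r g) (f x) < s)%R].
have mC g : measurable (C g).
  rewrite -[X in measurable X]setTI.
  apply: (measurable_fun_ltr _ _ measurableT (Y := [set true])) => //.
  exact: measurable_dot.
(* Numbering by naturals lets [seqDU] select the first optimal direction. Indices beyond [M] are
   sent to [ord0], so their disjointed events are empty. *)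
pose F (n : nat) := [set omega | optimal r S (fun i => f (Xs i omega)) (inord n)].
have sF n : <<s cylinders S >> (F n).
  (* Measurability is taken in the sigma-algebra generated by the cylinders. *)
  apply: (@measurable_optimal R _ (g_sigma_algebraType (cylinders S)) N D M.+1 r S
    (fun omega i => f (Xs i omega))).
  move=> i j iS; apply: (measurableT_comp (mf j)) => _ B mB; rewrite setTI.
  apply: sub_sigma_algebra; exists (fun l => if l == i then B else setT).
    move=> l; split; first by case: ifPn.
    by case: eqP => // -> iS'; rewrite iS' in iS.
  apply/seteqP; split=> x /=.
    by move=> Bx l _ /=; case: eqP => // ->.
  by move=> /(_ i I)/=; rewrite eqxx.
have sDF n : <<s cylinders S >> (seqDU F n).
  exact: (@seqDU_measurable _ (g_sigma_algebraType (cylinders S)) F sF).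
have sub A : <<s cylinders S >> A -> measurable A.
  apply: smallest_sub; last first.
    by move=> _ [B hB ->]; apply: measurable_capXs => i; have [] := hB i.
  exact: sigma_algebra_measurable.
pose Q n := \bigcap_(i in [set i | i \in S]) (Xs i @^-1` C (inord n)).
have mQ n : measurable (Q n) by apply: measurable_capXs.
have mDQ n : measurable (seqDU F n `&` Q n) by apply: measurableI => //; exact: sub.
have PDQ n : (P (seqDU F n `&` Q n) <= (q ^+ #|S|)%:E * P (seqDU F n))%E.
  rewrite independent_cylinder// muleC lee_wpmul2r//.
  rewrite (eq_bigr (fun=> (fine (mu (C (inord n))))%:E)); last first.
    by move=> i _; rewrite PXs// fineK ?fin_num_measure.
  rewrite prodEFin prodr_const lee_fin lerXn2r ?nnegrE ?fine_ge0//.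
  by rewrite -lee_fin fineK ?fin_num_measure//; exact: hq.
exists (\bigcup_n (seqDU F n `&` Q n)); split.
- exact: bigcup_measurable.
- rewrite measure_semi_bigcup//; [|exact: trivIset_setIr|exact: bigcup_measurable].
  apply: (@le_trans _ _ (\sum_(n <oo) (q ^+ #|S|)%:E * P (seqDU F n)))%E.
    by apply: lee_nneseries => n _ //; exact: PDQ.
  rewrite nneseriesZl// -measure_semi_bigcup//; last 2 first.
  + by move=> n; exact: sub.
  + by apply: bigcup_measurable => n _; exact: sub.
  by rewrite -[leRHS]mule1 lee_wpmul2l ?lee_fin ?exprn_ge0// probability_le1//;
    apply: bigcup_measurable => n _; exact: sub.
- move=> omega h.
  have [g og] := exists_optimal r S (fun i => f (Xs i omega)) (ltn0Sn M).
  have : (\bigcup_n F n) omega by exists g => //; rewrite /F/= inord_val.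
  rewrite seqDU_bigcup_eq => -[n _ Dn]; exists n => //; split=> // i _ /=.
  by apply: h; exact: (subset_seqDU Dn).
Qed.

End independent_test.

(** * Bounded integrals and the mass of half-spaces *)

Section bounded_integrals.
Context {R : realType} {d : measure_display} {X : measurableType d}
  (mu : probability X R).
Implicit Types f g : X -> R.

Lemma integrable_bounded f (M : R) : measurable_fun setT f ->
  (forall x, `|f x| <= M) -> mu.-integrable setT (EFin \o f).
Proof.
move=> mf fM; apply: measurable_bounded_integrable => //.
  by apply: (le_lt_trans (probability_le1 mu measurableT)); rewrite ltry.
exists M; split; first exact: num_real.
by move=> y My x _ /=; rewrite (le_trans (fM x))// ltW.
Qed.

Lemma integrable_cst (c : R) : mu.-integrable setT (EFin \o (fun=> c)).
Proof. exact: (integrable_bounded (M := `|c|)). Qed.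

Lemma integral_Rintegral f : mu.-integrable setT (EFin \o f) ->
  (\int[mu]_x (f x)%:E)%E = (\int[mu]_x f x)%:E.
Proof. by move=> fi; rewrite /Rintegral fineK//; exact: integrable_fin_num. Qed.

Lemma Rintegral_sum (I : Type) (s : seq I) (h : I -> X -> R) :
  (forall i, mu.-integrable setT (EFin \o h i)) ->
  \int[mu]_x (\sum_(i <- s) h i x) = \sum_(i <- s) \int[mu]_x h i x.
Proof.
move=> hi; apply: EFin_inj; rewrite -sumEFin.
under [RHS]eq_bigr do rewrite -integral_Rintegral//.
rewrite -integral_sum// -integral_Rintegral; last first.
  apply: (eq_integrable _ (fun x => \sum_(i <- s) (h i x)%:E)%E) => //.
    by move=> x _; rewrite /= sumEFin.
  by apply: integrable_sum => // i _; exact: hi.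
by apply: eq_integral => x _; rewrite sumEFin.
Qed.

Lemma Rintegral_markov f (a : R) : mu.-integrable setT (EFin \o f) ->
  (forall x, 0 <= f x) -> 0 < a ->
  (a%:E * mu [set x | (a <= f x)%R] <= (\int[mu]_x f x)%:E)%E.
Proof.
move=> fi f0 a0; rewrite -integral_Rintegral//.
have := le_integral_abse mu measurableT (measurable_int _ fi) a0.
rewrite setTI => h; apply: (le_trans _ (le_trans h _)).
  apply: lee_wpmul2l; first by rewrite lee_fin ltW.
  rewrite le_eqVlt; apply/orP; left; apply/eqP; congr (mu _).
  by apply/seteqP; split=> x /=; rewrite lee_fin ger0_norm.
rewrite le_eqVlt; apply/orP; left; apply/eqP.
by apply: eq_integral => x _ /=; rewrite ger0_norm.
Qed.

Lemma Rintegral_probability_cst (c : R) : \int[mu]_x c = c.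
Proof. by rewrite Rintegral_cst//= probability_setT mulr1. Qed.

(* Markov's inequality for the nonnegative variable [K - <u, f>], of mean [K]. *)
Lemma halfspace_mass (D : nat) (f : X -> 'I_D -> R) (K s : R) (u : 'I_D -> R) :
  0 < K -> 0 <= s -> (forall j, measurable_fun setT (f^~ j)) ->
  (forall x, dot (f x) (f x) <= K ^+ 2) -> (forall j, \int[mu]_x f x j = 0) ->
  dot u u <= 1 ->
  (mu [set x | (dot u (f x) < - s)%R] <= (K / (K + s))%:E)%E.
Proof.
move=> K0 s0 mf fK f0 u1.
have fj x j : `|f x j| <= K.
  rewrite -ler_sqr ?nnegrE ?(ltW K0)// real_normK ?num_real//.
  apply: le_trans (fK x); rewrite /dot (bigD1 j)//= -expr2 lerDl sumr_ge0//.
  by move=> l _; rewrite -expr2 sqr_ge0.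
have fi j : mu.-integrable setT (EFin \o f^~ j).
  by apply: (@integrable_bounded _ K) => // x; exact: fj.
pose V x := dot u (f x).
have mV : measurable_fun setT V by exact: measurable_dot.
have VK x : `|V x| <= K.
  rewrite -ler_sqr ?nnegrE ?(ltW K0)// real_normK ?num_real//.
  rewrite (le_trans (dot_cauchy _ _))// -[leRHS]mul1r.
  by apply: ler_pM => //; exact: dot_ge0.
have Vi : mu.-integrable setT (EFin \o V) by exact: integrable_bounded VK.
have V0 : \int[mu]_x V x = 0.
  rewrite /V /dot Rintegral_sum.
    by rewrite big1// => j _; rewrite RintegralZl// f0 mulr0.
  move=> j; apply: (@integrable_bounded _ (`|u j| * K)).
    by apply: measurable_funM => //; exact: measurable_cst.
  by move=> x; rewrite normrM ler_wpM2l.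
pose W x := K - V x.
have Wi : mu.-integrable setT (EFin \o W).
  apply: (@integrable_bounded _ (K + K)).
    by apply: measurable_funB => //; exact: measurable_cst.
  by move=> x; rewrite (le_trans (ler_normB _ _))// lerD// ger0_norm// ltW.
have W0 x : 0 <= W x by rewrite subr_ge0 (le_trans (ler_norm _)).
have IW : \int[mu]_x W x = K.
  have Ki : mu.-integrable setT (EFin \o (fun=> K)).
    by apply: (@integrable_bounded _ K) => [//|x]; rewrite ger0_norm// ltW.
  by rewrite RintegralB// V0 subr0 Rintegral_probability_cst.
have Ks : 0 < K + s by rewrite ltr_wpDr.
have := Rintegral_markov Wi W0 Ks; rewrite IW => h.
have mC : measurable [set x | (K + s <= W x)%R].
  rewrite -[X in measurable X]setTI.
  apply: (measurable_fun_ler _ _ measurableT (Y := [set true])) => //.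
  by apply: measurable_funB => //; exact: measurable_cst.
apply: (@le_trans _ _ (mu [set x | (K + s <= W x)%R])).
  apply: le_measure; rewrite ?inE//.
    rewrite -[X in measurable X]setTI.
    by apply: (measurable_fun_ltr _ _ measurableT (Y := [set true])).
  move=> x /= h1; rewrite /W; move: h1; rewrite -/(V x); lra.
by rewrite -(@lee_pmul2l _ (K + s)%:E) ?lte_fin// -EFinM mulrCA divff ?mulr1 ?gt_eqF.
Qed.

End bounded_integrals.

(** * Convex hulls of random points *)

Lemma bernoulli_ineq (R : realType) (x : R) (m : nat) : 0 <= x ->
  1 + m%:R * x <= (1 + x) ^+ m.
Proof.
move=> x0; elim: m => [|m IH]; first by rewrite mul0r addr0 expr0.
rewrite exprS (le_trans _ (ler_wpM2l _ IH)) ?addr_ge0//.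
rewrite -natr1; have : 0 <= m%:R * x * x by rewrite !mulr_ge0.
nra.
Qed.

(** Bernoulli's inequality gives [(n / (n + 1)) ^ n <= 1 / 2], hence a factor [2 ^- (3 * D)] for [L]
    tests, which outweighs the ratio [(5 / 2) ^ D.+1] of the binomials. *)
Lemma failure_budget (R : realType) (N D n L : nat) : (1 < D)%N -> (0 < n)%N ->
  L = (3 * D * n)%N -> (2 * L <= N)%N ->
  'C(N, L)%:R * ((1 + n%:R^-1)^-1) ^+ L <= 'C(N - D.+1, L)%:R * 2 ^- D :> R.
Proof.
move=> D1 n0 LE LN.
have q0 : 0 <= (1 + n%:R^-1 : R)^-1 by rewrite invr_ge0 addr_ge0 ?invr_ge0.
have q1 : (1 + n%:R^-1 : R)^-1 ^+ n <= 2^-1.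
  rewrite exprVn lef_pV2 ?posrE ?exprn_gt0 ?ltr_wpDr ?invr_ge0//.
  have := @bernoulli_ineq R n%:R^-1 n; rewrite invr_ge0 ler0n => /(_ isT).
  by rewrite divff// pnatr_eq0 -lt0n.
have qL : (1 + n%:R^-1 : R)^-1 ^+ L <= 2^-1 ^+ (3 * D).
  by rewrite LE mulnC exprM lerXn2r ?nnegrE ?exprn_ge0.
have bL : (3 * (D.+1).-1 <= L)%N by rewrite /= LE leq_pmulr.
have C : 'C(N, L)%:R <= 'C(N - D.+1, L)%:R * (5 / 2) ^+ D.+1 :> R.
  rewrite expr_div_n mulrA ler_pdivlMr ?exprn_gt0// mulrC [leRHS]mulrC.
  by have := binomial_ratio LN bL; rewrite -(ler_nat R) !natrM !natrX.
have small : (5 / 2) ^+ D.+1 * 2^-1 ^+ (3 * D) <= 2 ^- D :> R.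
  rewrite exprM -exprVn exprS -mulrA -exprMn.
  have -> : 5 / 2 * 2^-1 ^+ 3 = 5 / 16 :> R by field.
  (* This amounts to [5 / 2 <= (8 / 5) ^ D], which fails for [D = 1] and holds from [D = 2] on. *)
  have aux m : 5 / 2 * (5 / 16) ^+ m.+2 <= 2^-1 ^+ m.+2 :> R.
    elim: m => [|m IH]; first by rewrite !expr2; lra.
    have p0 : 0 <= (5 / 16 : R) ^+ m.+2 by rewrite exprn_ge0// divr_ge0.
    by rewrite exprS [leRHS]exprS; lra.
  by case: D D1 {LE qL bL C} => [|[|m]] // _; exact: aux.
apply: (le_trans (ler_pM _ _ C qL)); rewrite ?exprn_ge0//.
by rewrite -mulrA ler_wpM2l.
Qed.

Section random_hull.
Context {R : realType} {d0 d1 : measure_display} {Omega : measurableType d0}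
  {X : measurableType d1} (P : probability Omega R) (mu : probability X R)
  (N : nat) (Xs : 'I_N -> Omega -> X).
Hypothesis mXs : forall i, measurable_fun setT (Xs i).
Hypothesis PXs : forall i (A : set X), measurable A -> P (Xs i @^-1` A) = mu A.
Hypothesis indXs : mutually_independent P Xs.

(* The failure of the whole sample is witnessed by at most [D.+1] points, so
   it forces the test of [selected_direction_bound] to succeed for every [S]
   avoiding these points, a fixed proportion of all [S] of size [3Dn]. *)
Theorem random_hull (D n : nat) (f : X -> 'I_D -> R) (K : R) :
  (1 < D)%N -> (0 < n)%N -> (6 * D * n <= N)%N -> 0 <= K ->
  (forall j, measurable_fun setT (f^~ j)) ->
  (forall x, dot (f x) (f x) <= K ^+ 2) -> (forall j, \int[mu]_x f x j = 0) ->
  exists E : set Omega, [/\ measurable E, (P E >= (1 - 2 ^- D)%:E)%E &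
    forall omega, E omega -> exists2 w : 'I_N -> R, simplex w &
      dot (comb w (fun i => f (Xs i omega))) (comb w (fun i => f (Xs i omega)))
        <= (2 * K / n%:R) ^+ 2].
Proof.
move=> D1 n0 DnN K0 mf fK f0.
have N0 : (0 < N)%N by move: DnN; nia.
have n0R : 0 < n%:R :> R by rewrite ltr0n.
(* If [K = 0], all features vanish and any vertex of the simplex works. *)
have [K0'|Kpos] := leP K 0.
  have {K0 K0'}KE : K = 0 by apply/eqP; rewrite eq_le K0'.
  exists setT; split => //.
    by rewrite probability_setT lee_fin lerBlDr lerDl invr_ge0 exprn_ge0.
  move=> omega _; exists (fun l => (l == Ordinal N0)%:R); first exact: simplex_vertex.
  by rewrite comb_vertex (le_trans (fK _))// KE mulr0 mul0r.
(* This choice makes [K / (K + eps / 2)] equal to [n / (n + 1)], the value of [q] below. *)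
pose eps := 2 * K / n%:R.
have eps0 : 0 < eps by rewrite divr_gt0 ?mulr_gt0.
pose delta := eps ^+ 3 / (8 * K ^+ 3).
have K3 : 0 < 8 * K ^+ 3 by apply: mulr_gt0 => //; exact: exprn_gt0.
have delta0 : 0 < delta by apply: divr_gt0 => //; exact: exprn_gt0.
have hdelta : 8 * K ^+ 3 * delta <= eps ^+ 3.
  by rewrite mulrC divfK// gt_eqF.
have [M' [r [M'0 [r1 net]]]] := unit_ball_net D delta0.
case: M' M'0 r r1 net => [//|M] _ r r1 net.
pose L := (3 * D * n)%N.
have LN : (2 * L <= N)%N by rewrite /L; move: DnN; lia.
pose q : R := (1 + n%:R^-1)^-1.
have q0 : 0 <= q by rewrite invr_ge0 addr_ge0 ?invr_ge0.
have hq g : (mu [set x | (dot (r g) (f x) < - (eps / 2))%R] <= q%:E)%E.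
  have -> : q = K / (K + eps / 2).
    rewrite /q /eps; field; rewrite !gt_eqF ?addr_gt0 ?mulr_gt0//.
  by apply: halfspace_mass => //; rewrite divr_ge0// ltW.
have [G HG] := choice (fun S : {set 'I_N} =>
  selected_direction_bound mXs indXs S PXs mf hq).
have mG S : measurable (G S) by have [] := HG S.
pose draws := [set S : {set 'I_N} | #|S| == L]%SET.
have cdraws : #|draws| = 'C(N, L).
  rewrite -[in RHS](card_ord N) -cardsT -cards_draws.
  by apply: eq_card => S; rewrite !inE finset.subsetT.
(* The number of sets [S] of size [L] for which [G S] occurs; a failing sample has at least [c] of
   them. *)
pose cnt omega : R := \sum_(S <- enum draws) \1_(G S) omega.
have mcnt : measurable_fun setT cnt.
  by apply: measurable_sum => S; exact: measurable_indic.
have ind01 S omega : 0 <= (\1_(G S) omega : R) <= 1 by rewrite indicE ler0n lern1 leq_b1.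
have cnt0 omega : 0 <= cnt omega.
  by apply: sumr_ge0 => S _; have /andP[] := ind01 S omega.
have icnt : P.-integrable setT (EFin \o cnt).
  apply: (@integrable_bounded _ _ _ _ _ #|draws|%:R) => // omega.
  rewrite ger0_norm// /cnt cardE -sum1_size natr_sum; apply: ler_sum => S _.
  by have /andP[] := ind01 S omega.
pose c := 'C(N - D.+1, L).
(* Markov's inequality divides by [c], which is positive because [L + D.+1 <= 2 * L <= N]. *)
have c0 : 0 < c%:R :> R.
  rewrite ltr0n bin_gt0; have : (D < L)%N by rewrite /L; nia.
  lia.
pose E := ~` [set omega | (c%:R <= cnt omega)%R].
have mEc : measurable [set omega | (c%:R <= cnt omega)%R].
  rewrite -[X in measurable X]setTI.
  by apply: (measurable_fun_ler _ _ measurableT (Y := [set true])).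
exists E; split; first exact: measurableC.
- have PEc : (P [set omega | (c%:R <= cnt omega)%R] <= (2 ^- D)%:E)%E.
    rewrite -(@lee_pmul2l _ c%:R%:E) ?lte_fin//.
    apply: (le_trans (Rintegral_markov icnt cnt0 c0)).
    (* The mean of [cnt] is at most ['C(N, L) * q ^+ L], each [G S] having probability at most
       [q ^+ L]. *)
    rewrite -EFinM lee_fin (le_trans _ (failure_budget R D1 n0 erefl LN))//.
    rewrite /cnt Rintegral_sum; last by move=> S; exact: integrable_indic.
    rewrite -cdraws cardE -sum1_size natr_sum mulr_suml big_seq [leRHS]big_seq.
    apply: ler_sum => S; rewrite mem_enum inE => /eqP SL; rewrite mul1r.
    have [_ h _] := HG S; rewrite SL in h.
    by rewrite /Rintegral integral_indic// setIT -lee_fin fineK ?fin_num_measure.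
  rewrite probability_setC// EFinB; exact: leeB.
move=> omega nE; apply: contrapT => fail.
have far w : simplex w -> eps ^+ 2 <
    dot (comb w (fun i => f (Xs i omega))) (comb w (fun i => f (Xs i omega))).
  by move=> sw; rewrite ltNge; apply/negP => h; apply: fail; exists w.
have [w [B [rho [sw BD wB erho [pp pY]]]]] := separating_point N0 (ltW eps0) far.
apply: nE => /=.
have GS (S : {set 'I_N}) : S \subset ~: B -> G S omega.
  move=> SB; have [_ _] := HG S; apply => g og.
  apply: (optimal_separates Kpos eps0 delta0 hdelta r1 net _ sw wB erho pp pY _ og) => //.
  by move=> i iS; move/fintype.subsetP: SB => /(_ i iS); rewrite inE.
have := card_disjoint_draws L BD; rewrite -(ler_nat R) => /le_trans; apply.
rewrite /cnt big_enum/= -sum1_card natr_sum big_mkcond [leRHS]big_mkcond/=.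
apply: ler_sum => S _; rewrite !inE; case: ifPn => [/andP[SB SL]|_].
  by rewrite SL indicE mem_set//; exact: GS.
by case: ifPn => // _; have /andP[] := ind01 S omega.
Qed.

End random_hull.

(** * Kernel expansions in the RKHS *)

Section rkhs_approximation.
Context {X : Type} {R : realType} (k : X -> X -> R) (H : set (X -> R))
  (ip : (X -> R) -> (X -> R) -> R).
Hypothesis hH : is_RKHS k H ip.

Definition kcomb (s : seq (R * X)) : X -> R :=
  fun x => \sum_(p <- s) p.1 * k p.2 x.

Lemma kcomb_cons p s : kcomb (p :: s) = fun x => p.1 * k p.2 x + kcomb s x.
Proof. by apply: funext => x; rewrite /kcomb big_cons. Qed.

Lemma kcomb_scale (t : R) s :
  kcomb [seq (t * p.1, p.2) | p <- s] = fun x => t * kcomb s x.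
Proof.
apply: funext => x; rewrite /kcomb big_map mulr_sumr.
by apply: eq_bigr => p _ /=; rewrite mulrA.
Qed.

Lemma ip0l f : H f -> ip (fun=> 0) f = 0.
Proof.
have [H0 [_ [_ [iplin _]]]] := hH => Hf.
have := iplin 1 (fun=> 0) (fun=> 0) f H0 H0 Hf.
have -> : (fun y : X => 1 * 0 + 0) = fun=> 0 :> R.
  by apply: funext => y; rewrite mulr0 addr0.
lra.
Qed.

Lemma ip_normD (a : R) f g : H f -> H g ->
  ip (fun y => a * f y + g y) (fun y => a * f y + g y) =
  a ^+ 2 * ip f f + 2 * a * ip f g + ip g g.
Proof.
have [_ [Hlin [ipC [iplin _]]]] := hH => Hf Hg.
have Hc := Hlin a f g Hf Hg.
rewrite iplin// (ipC f)// (ipC g)// !iplin// (ipC g f)//; ring.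
Qed.

Lemma kcomb_mem s : H (kcomb s).
Proof.
have [H0 [Hlin [_ [_ [_ [_ [Hk _]]]]]]] := hH.
elim: s => [|p s IH]; last by rewrite kcomb_cons; exact: Hlin.
by rewrite (_ : kcomb [::] = fun=> 0)//; apply: funext => x; rewrite /kcomb big_nil.
Qed.

Lemma ip_kcomb s f : H f -> ip (kcomb s) f = \sum_(p <- s) p.1 * f p.2.
Proof.
have [H0 [Hlin [ipC [iplin [_ [_ [Hk repr]]]]]]] := hH => Hf.
elim: s => [|p s IH].
  rewrite big_nil (_ : kcomb [::] = fun=> 0) ?ip0l//.
  by apply: funext => x; rewrite /kcomb big_nil.
rewrite kcomb_cons iplin//; last exact: kcomb_mem.
by rewrite big_cons IH ipC// repr.
Qed.

(* A near minimiser [h] of the distance to [f] among kernel combinations is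
   nearly orthogonal to [f - h] in every direction [k x], i.e. [f x - h x] is
   small uniformly in [x]; rescaling it optimally makes its norm at most that of [f]. *)
Lemma kcomb_dense (C eta : R) f : (forall x, k x x <= C) -> 0 <= C -> 0 < eta ->
  H f -> exists s, (forall x, `|f x - kcomb s x| <= eta) /\
    ip (kcomb s) (kcomb s) <= ip f f.
Proof.
have [H0 [Hlin [ipC [iplin [ippos [_ [Hk repr]]]]]]] := hH => kC C0 eta0 Hf.
pose J s := ip f f - 2 * ip (kcomb s) f + ip (kcomb s) (kcomb s).
have JE s : J s = ip (fun y => -1 * kcomb s y + f y) (fun y => -1 * kcomb s y + f y).
  by rewrite ip_normD//; [rewrite /J; ring|exact: kcomb_mem].
have J0 s : 0 <= J s.
  by rewrite JE; apply (ippos _ (Hlin _ _ _ (kcomb_mem s) Hf)).1.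
have hinf : has_inf (range J).
  by split; [exists (J [::]), [::]|exists 0 => _ [s _ <-]].
(* A gap [tau] in the squared distance [J] will become a pointwise error [eta]; [C + 1] stands in
   for [C], which may be 0. *)
pose tau := eta ^+ 2 / (C + 1).
have C1 : 0 < C + 1 by rewrite ltr_wpDl.
have tau0 : 0 < tau by rewrite divr_gt0// exprn_gt0.
have [_ [s0 _ <-] s0tau] := inf_adherent tau0 hinf.
have [s [ss0 hs]] : exists s, J s <= J s0 /\ ip (kcomb s) (kcomb s) <= ip f f.
  have [hh0|hh0] := eqVneq (ip (kcomb s0) (kcomb s0)) 0.
    exists s0; split=> //; rewrite hh0; exact: (ippos _ Hf).1.
  have hhpos : 0 < ip (kcomb s0) (kcomb s0).
    by rewrite lt_def hh0; exact: (ippos _ (kcomb_mem s0)).1.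
  (* Orthogonal projection of [f] onto the line of [kcomb s0]: the distance does not grow, and the
     norm becomes at most that of [f]. *)
  pose t := ip (kcomb s0) f / ip (kcomb s0) (kcomb s0).
  pose s := [seq (t * p.1, p.2) | p <- s0].
  have Hs0 := kcomb_mem s0.
  have sE : kcomb s = fun y => t * kcomb s0 y + 0.
    by rewrite kcomb_scale; apply: funext => y; rewrite addr0.
  have n1 : ip (kcomb s) (kcomb s) = t ^+ 2 * ip (kcomb s0) (kcomb s0).
    rewrite sE (ip_normD t Hs0 H0) (ipC _ _ Hs0 H0) !ip0l//; ring.
  have n2 : ip (kcomb s) f = t * ip (kcomb s0) f by rewrite sE iplin// ip0l// addr0.
  have n3 : t * ip (kcomb s0) f = t ^+ 2 * ip (kcomb s0) (kcomb s0).
    by rewrite /t; field.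
  exists s; split; last first.
    have := J0 s; rewrite /J n1 n2 n3; lra.
  rewrite /J n1 n2 n3 -subr_ge0.
  have n4 : ip (kcomb s0) f = t * ip (kcomb s0) (kcomb s0) by rewrite /t divfK.
  rewrite n4.
  have := mulr_ge0 (sqr_ge0 (1 - t)) (ltW hhpos); nra.
exists s; split=> // x.
set g := f x - kcomb s x.
(* Adding the node [x] with coefficient [t] can lower the squared distance by at most [tau]. *)
have step t : 2 * t * g <= t ^+ 2 * C + tau.
  have Js : J ((t, x) :: s) = J s - 2 * t * g + t ^+ 2 * k x x.
    rewrite /J kcomb_cons/= (iplin t)//; last exact: kcomb_mem.
    rewrite (ip_normD t (Hk x) (kcomb_mem s)) (ipC (k x) f)// repr//.
    by rewrite (ipC (k x))// ?repr//; [rewrite /g; ring|exact: kcomb_mem|exact: kcomb_mem].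
  have : inf (range J) <= J ((t, x) :: s) by apply: ge_inf; [case: hinf|exists ((t, x) :: s)].
  have : t ^+ 2 * k x x <= t ^+ 2 * C by rewrite ler_wpM2l ?sqr_ge0.
  rewrite Js; lra.
rewrite -ler_sqr ?nnegrE ?(ltW eta0)// real_normK ?num_real//.
(* The minimiser of [t ^+ 2 * (C + 1) - 2 * t * g]. *)
have := step (g / (C + 1)).
have -> : 2 * (g / (C + 1)) * g = 2 * (g ^+ 2 / (C + 1)) by field; rewrite gt_eqF.
have : (g / (C + 1)) ^+ 2 * C <= g ^+ 2 / (C + 1).
  have -> : (g / (C + 1)) ^+ 2 * C = (g ^+ 2 / (C + 1)) * (C / (C + 1)).
    by field; rewrite gt_eqF.
  rewrite ler_piMr// ?divr_ge0 ?sqr_ge0 ?ltW//.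
  by rewrite ltr_pdivrMr// mul1r ltrDl.
move=> h1 h2; have : g ^+ 2 / (C + 1) <= eta ^+ 2 / (C + 1) by move: h1 h2; rewrite /tau; lra.
by rewrite ler_pM2r// invr_gt0.
Qed.

End rkhs_approximation.

(** * Mercer features and the quadrature error *)

(** Cauchy-Schwarz on the sums over [d <= j < n], then the limit in [n]. The case [d = 0] concerns
    the whole series. *)
Lemma tail_cauchy_schwarz (R : realType) (u v : nat -> R) (U V W : R) (d : nat) :
  series (fun j => u j * u j) n @[n --> \oo] --> U ->
  series (fun j => v j * v j) n @[n --> \oo] --> V ->
  series (fun j => u j * v j) n @[n --> \oo] --> W ->
  0 <= U - \sum_(j < d) u j ^+ 2 /\
  (W - \sum_(j < d) u j * v j) ^+ 2 <=
    (U - \sum_(j < d) u j ^+ 2) * (V - \sum_(j < d) v j ^+ 2).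
Proof.
have tailE (a b : nat -> R) n : (d <= n)%N ->
    series (fun j => a j * b j) n - \sum_(j < d) a j * b j = \sum_(d <= j < n) a j * b j.
  move=> dn; rewrite /series/= (big_cat_nat (leq0n d) dn)/= big_mkord addrAC subrr add0r//.
have sq (c : nat -> R) : \sum_(j < d) c j ^+ 2 = \sum_(j < d) c j * c j.
  by apply: eq_bigr => j _; rewrite expr2.
move=> cU cV cW; rewrite !sq.
have cU' : (series (fun j => u j * u j) n - \sum_(j < d) u j * u j) @[n --> \oo] -->
  U - \sum_(j < d) u j * u j by apply: cvgB => //; exact: cvg_cst.
have cV' : (series (fun j => v j * v j) n - \sum_(j < d) v j * v j) @[n --> \oo] -->
  V - \sum_(j < d) v j * v j by apply: cvgB => //; exact: cvg_cst.
have cW' : (series (fun j => u j * v j) n - \sum_(j < d) u j * v j) @[n --> \oo] -->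
  W - \sum_(j < d) u j * v j by apply: cvgB => //; exact: cvg_cst.
split.
  apply: (ler_cvg_to (cvg_cst 0) cU'); exists d => // n /= dn.
  by rewrite tailE//; apply: sumr_ge0 => j _; rewrite -expr2 sqr_ge0.
rewrite expr2; apply: (ler_cvg_to (cvgM cW' cW') (cvgM cU' cV')).
exists d => // n /= dn; rewrite !tailE// -expr2.
have sqn (c : nat -> R) : \sum_(d <= j < n) c j * c j = \sum_(d <= j < n) c j ^+ 2.
  by apply: eq_bigr => j _; rewrite expr2.
by rewrite !sqn; exact: cauchy_schwarz_sum.
Qed.

Lemma cvg_sum_seq (R : realType) (I : Type) (s : seq I) (u : I -> nat -> R) (l : I -> R) :
  (forall i, u i n @[n --> \oo] --> l i) ->
  (\sum_(i <- s) u i n) @[n --> \oo] --> \sum_(i <- s) l i.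
Proof.
move=> ul; elim: s => [|i s IH].
  by rewrite big_nil; under eq_fun do rewrite big_nil; exact: cvg_cst.
rewrite big_cons; under eq_fun do rewrite big_cons; exact: cvgD.
Qed.

Section mercer.
Context {R : realType} {d1 : measure_display} {X : measurableType d1}
  (mu : probability X R) (k : X -> X -> R) (H : set (X -> R))
  (ip : (X -> R) -> (X -> R) -> R) (phi : nat -> X -> R) (kap : R) (d : nat).
Hypothesis hH : is_RKHS k H ip.
Hypothesis mphi : forall j, measurable_fun setT (phi j).
Hypothesis mercer : forall x y,
  series (fun j => phi j x * phi j y) n @[n --> \oo] --> k x y.
Hypothesis kap0 : 0 <= kap.
Hypothesis kk : forall x, k x x <= kap ^+ 2.

(** Root of the diagonal of the kernel left after [d] terms; the radicand is nonnegative by the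
    Mercer expansion. *)
Definition rest x : R := Num.sqrt (k x x - \sum_(j < d) phi j x ^+ 2).

Definition feat x (j : 'I_d.+1) : R := if (j < d)%N then phi j x else rest x.

Definition cfeat x j : R := feat x j - \int[mu]_y feat y j.

Lemma rest_sqr x : rest x ^+ 2 = k x x - \sum_(j < d) phi j x ^+ 2.
Proof.
by rewrite sqr_sqrtr//; have [] := tail_cauchy_schwarz d (@mercer x x) (@mercer x x) (@mercer x x).
Qed.

Lemma sum_feat (u : 'I_d.+1 -> R) x :
  \sum_(j < d.+1) u j * feat x j =
  \sum_(j < d) u (widen_ord (leqnSn d) j) * phi j x + u ord_max * rest x.
Proof.
rewrite big_ord_recr/= {2}/feat/= ltnn; congr (_ + _).
by apply: eq_bigr => j _; rewrite /feat/= ltn_ord.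
Qed.

Lemma dot_feat x : dot (feat x) (feat x) = k x x.
Proof.
have fm : feat x ord_max = rest x by rewrite /feat/= ltnn.
rewrite /dot sum_feat fm -expr2 rest_sqr (eq_bigr (fun j : 'I_d => phi j x ^+ 2)).
  by rewrite addrC subrK.
by move=> j _; rewrite /feat/= ltn_ord expr2.
Qed.

Lemma measurable_kernel y : measurable_fun setT (k y).
Proof.
apply: (@measurable_fun_cvg _ _ _ _ (fun n x => series (fun j => phi j y * phi j x) n)).
  move=> n; apply: measurable_sum => j.
  by apply: measurable_funM => //; exact: measurable_cst.
by move=> x _; exact: mercer.
Qed.

Lemma measurable_rest : measurable_fun setT rest.
Proof.
apply: (measurableT_comp (continuous_measurable_fun (@sqrt_continuous R))).
apply: measurable_funB; last first.
  by apply: measurable_sum => j; exact: measurable_funX.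
apply: (@measurable_fun_cvg _ _ _ _ (fun n x => series (fun j => phi j x * phi j x) n)).
  by move=> n; apply: measurable_sum => j; exact: measurable_funM.
by move=> x _; exact: mercer.
Qed.

Lemma measurable_feat j : measurable_fun setT (feat^~ j).
Proof.
have [jd|jd] := boolP (j < d)%N.
  by rewrite (_ : feat^~ j = phi j)//; apply: funext => x; rewrite /feat jd.
rewrite (_ : feat^~ j = rest); first exact: measurable_rest.
by apply: funext => x; rewrite /feat (negPf jd).
Qed.

Lemma feat_le x j : `|feat x j| <= kap.
Proof.
rewrite -ler_sqr ?nnegrE// real_normK ?num_real//.
apply: le_trans (kk x); rewrite -dot_feat /dot (bigD1 j)//= -expr2 lerDl sumr_ge0//.
by move=> l _; rewrite -expr2 sqr_ge0.
Qed.

Lemma integrable_feat j : mu.-integrable setT (EFin \o feat^~ j).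
Proof.
by apply: (integrable_bounded _ (M := kap)); [exact: measurable_feat|move=> x; exact: feat_le].
Qed.

Lemma measurable_cfeat j : measurable_fun setT (cfeat^~ j).
Proof.
by apply: measurable_funB; [exact: measurable_feat|exact: measurable_cst].
Qed.

Lemma cfeat_mean0 j : \int[mu]_x cfeat x j = 0.
Proof.
rewrite /cfeat RintegralB//; [|exact: integrable_feat|exact: integrable_cst].
by rewrite Rintegral_probability_cst subrr.
Qed.

(** The mean [m] of the features has norm at most [kap], since [|m|^2] is the mean of [<m, feat y>],
    which is at most [|m| * kap]. Expanding the square then gives the bound. *)
Lemma dot_cfeat x : dot (cfeat x) (cfeat x) <= (2 * kap) ^+ 2.
Proof.
pose m j := \int[mu]_y feat y j.
pose a := Num.sqrt (dot m m).
have a2 : a ^+ 2 = dot m m by rewrite sqr_sqrtr// dot_ge0.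
have a0 : 0 <= a by exact: sqrtr_ge0.
have fk y : dot (feat y) (feat y) <= kap ^+ 2 by rewrite dot_feat.
have mf y : dot m (feat y) <= a * kap by apply: dot_le => //; rewrite a2.
have imf : mu.-integrable setT (EFin \o (fun y => dot m (feat y))).
  apply: (integrable_bounded _ (M := a * kap)).
    by apply: measurable_dot; exact: measurable_feat.
  move=> y; rewrite -ler_sqr ?nnegrE ?mulr_ge0// real_normK ?num_real//.
  by rewrite (le_trans (dot_cauchy _ _))// exprMn a2 ler_wpM2l// dot_ge0.
have ak : a <= kap.
  have : dot m m <= a * kap.
    have -> : dot m m = \int[mu]_y dot m (feat y).
      rewrite /dot Rintegral_sum; last first.
        move=> j; apply: (integrable_bounded _ (M := `|m j| * kap)).
          by apply: measurable_funM; [exact: measurable_cst|exact: measurable_feat].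
        by move=> y; rewrite normrM ler_wpM2l// feat_le.
      by apply: eq_bigr => j _; rewrite RintegralZl//; exact: integrable_feat.
    rewrite -[leRHS](Rintegral_probability_cst mu); apply: le_Rintegral => //.
    exact: integrable_cst.
  rewrite -a2; have [->//|aN0] := eqVneq a 0.
  by rewrite expr2 ler_pM2l// lt_def aN0.
have -> : cfeat x = fun j => 1 * feat x j + (-1) * m j.
  by apply: funext => j; rewrite mul1r mulN1r.
rewrite dot_linl !dot_linr (dotC (feat x)) -a2.
have : - dot m (feat x) <= kap * kap.
  (* The vector is [- m], written in the form that [dot_linl] expands. *)
  have := @dot_le _ _ (fun j => -1 * m j + 0 * m j) (feat x) a kap a0 kap0.
  rewrite !dot_linl !dot_linr -a2 => h.
  have : -1 * dot m (feat x) + 0 * dot m (feat x) <= a * kap by apply: h; [lra|exact: fk].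
  have : a * kap <= kap * kap by rewrite ler_wpM2r.
  lra.
have : a ^+ 2 <= kap ^+ 2 by rewrite ler_sqr.
have := fk x; rewrite exprMn expr2; lra.
Qed.

(** Coefficients of [kcomb k s] in the family [phi], read off from the Mercer expansion. *)
Definition kcoef (s : seq (R * X)) (j : nat) : R := \sum_(p <- s) p.1 * phi j p.2.

Lemma kcomb_series s x :
  series (fun j => kcoef s j * phi j x) n @[n --> \oo] --> kcomb k s x.
Proof.
rewrite (_ : (fun n => _) = fun n =>
    \sum_(p <- s) p.1 * series (fun j => phi j p.2 * phi j x) n).
  by apply: cvg_sum_seq => p; apply: cvgM; [exact: cvg_cst|exact: mercer].
apply: funext => n; rewrite /series/= /kcoef.
under eq_bigr do rewrite mulr_suml.
rewrite exchange_big/=; apply: eq_bigr => p _; rewrite mulr_sumr.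
by apply: eq_bigr => j _; rewrite mulrA.
Qed.

(** A Parseval identity: the reproducing property reduces the squared norm to values at the nodes,
    which [kcomb_series] expands. *)
Lemma kcoef_series s :
  series (fun j => kcoef s j * kcoef s j) n @[n --> \oo] -->
  ip (kcomb k s) (kcomb k s).
Proof.
rewrite (ip_kcomb hH _ (kcomb_mem hH s)).
rewrite (_ : (fun n => _) = fun n =>
    \sum_(p <- s) p.1 * series (fun j => kcoef s j * phi j p.2) n).
  by apply: cvg_sum_seq => p; apply: cvgM; [exact: cvg_cst|exact: kcomb_series].
apply: funext => n; rewrite /series/=.
under eq_bigr do rewrite {2}/kcoef mulr_sumr.
rewrite exchange_big/=; apply: eq_bigr => p _; rewrite mulr_sumr.
by apply: eq_bigr => j _; rewrite mulrCA.
Qed.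

Lemma measurable_kcomb s : measurable_fun setT (kcomb k s).
Proof.
apply: measurable_sum => p.
by apply: measurable_funM; [exact: measurable_cst|exact: measurable_kernel].
Qed.

Lemma kcomb_le s x : ip (kcomb k s) (kcomb k s) <= 1 -> `|kcomb k s x| <= kap.
Proof.
move=> h1; rewrite -ler_sqr ?nnegrE// real_normK ?num_real//.
have [h0] := tail_cauchy_schwarz 0 (@kcoef_series s) (@mercer x x) (@kcomb_series s x).
rewrite !big_ord0 !subr0 in h0 *; move=> /le_trans; apply.
rewrite -[leRHS]mul1r; apply: ler_pM => //.
by have [] := tail_cauchy_schwarz 0 (@mercer x x) (@mercer x x) (@mercer x x);
  rewrite big_ord0 subr0.
Qed.

(** The first [d] terms have error [<a, v>] over the first [d] coordinates. The remainder [high] is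
    at most [b * rest], so its integral and its quadrature are at most [b * tau] and
    [b * (v ord_max + tau)] in absolute value. Grouping [b * v ord_max] with the first error leaves
    one Cauchy-Schwarz bound [eps], plus [2 * b * tau]. *)
Lemma kcomb_quadrature s (N : nat) (w : 'I_N -> R) (xs : 'I_N -> X) (eps : R) :
  ip (kcomb k s) (kcomb k s) <= 1 -> simplex w -> 0 <= eps ->
  dot (comb w (fun i => cfeat (xs i))) (comb w (fun i => cfeat (xs i))) <= eps ^+ 2 ->
  `|\int[mu]_x kcomb k s x - \sum_(i < N) w i * kcomb k s (xs i)|
    <= 2 * \int[mu]_x rest x + eps.
Proof.
move=> h1 [w0 w1] eps0; set v := comb w _ => vv.
set h := kcomb k s; set tau := \int[mu]_x rest x.
pose a := kcoef s; pose b := Num.sqrt (ip h h - \sum_(j < d) a j ^+ 2).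
pose low x := \sum_(j < d) a j * phi j x.
pose high x := h x - low x.
have tcs x := tail_cauchy_schwarz d (@kcoef_series s) (@mercer x x) (@kcomb_series s x).
have b2 : b ^+ 2 = ip h h - \sum_(j < d) a j ^+ 2.
  by rewrite sqr_sqrtr//; have [] := tcs point.
have b0 : 0 <= b by exact: sqrtr_ge0.
have a2 : 0 <= \sum_(j < d) a j ^+ 2 by apply: sumr_ge0 => j _; exact: sqr_ge0.
have b1 : b <= 1 by rewrite -(@ler_sqr R) ?nnegrE// expr1n b2; lra.
have rest0 x : 0 <= rest x by exact: sqrtr_ge0.
have highb x : `|high x| <= b * rest x.
  rewrite -ler_sqr ?nnegrE ?mulr_ge0// real_normK ?num_real// exprMn b2 rest_sqr.
  by have [] := tcs x.
have restE x : rest x = feat x ord_max by rewrite /feat/= ltnn.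
have phiE (j : 'I_d) x : phi j x = feat x (widen_ord (leqnSn d) j).
  by rewrite /feat/= ltn_ord.
have irest : mu.-integrable setT (EFin \o rest).
  by have := integrable_feat ord_max; under eq_fun do rewrite -restE.
have iphi (j : 'I_d) : mu.-integrable setT (EFin \o phi j).
  have := integrable_feat (widen_ord (leqnSn d) j).
  by under eq_fun do rewrite -phiE.
have iaphi (j : 'I_d) : mu.-integrable setT (EFin \o (fun x => a j * phi j x)).
  apply: (integrable_bounded _ (M := `|a j| * kap)).
    by apply: measurable_funM => //; exact: measurable_cst.
  by move=> x; rewrite normrM ler_wpM2l// phiE feat_le.
have mlow : measurable_fun setT low.
  apply: measurable_sum => j; apply: measurable_funM => //; exact: measurable_cst.
have ihigh : mu.-integrable setT (EFin \o high).
  apply: (integrable_bounded _ (M := b * kap)).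
    by apply: measurable_funB => //; exact: measurable_kcomb.
  move=> x; rewrite (le_trans (highb x))// ler_wpM2l// restE.
  exact: le_trans (ler_norm _) (feat_le _ _).
have ih : mu.-integrable setT (EFin \o h).
  apply: (integrable_bounded _ (M := kap)); first exact: measurable_kcomb.
  by move=> x; exact: kcomb_le.
have ilow : \int[mu]_x low x = \sum_(j < d) a j * \int[mu]_x phi j x.
  by rewrite Rintegral_sum//; apply: eq_bigr => j _; rewrite RintegralZl.
have Ih : \int[mu]_x h x = \int[mu]_x low x + \int[mu]_x high x.
  have il : mu.-integrable setT (EFin \o low).
    apply: (eq_integrable _ (fun x => (h x)%:E - (high x)%:E)%E) => //.
      by move=> x _; rewrite /= -EFinB /high subKr.
    exact: integrableB.
  by rewrite -RintegralD//; apply: eq_Rintegral => x _; rewrite /high addrC subrK.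
have Ihigh : `|\int[mu]_x high x| <= b * tau.
  apply: (le_trans (le_normr_Rintegral measurableT ihigh)).
  rewrite /tau -RintegralZl//; apply: le_Rintegral => //.
    exact: integrable_norm.
  apply: (integrable_bounded _ (M := b * kap)).
    by apply: measurable_funM; [exact: measurable_cst|exact: measurable_rest].
  move=> x; rewrite normrM (ger0_norm b0) ler_wpM2l// restE; exact: feat_le.
have vE j : v j = \sum_(i < N) w i * feat (xs i) j - \int[mu]_x feat x j.
  rewrite /v /comb /cfeat; under eq_bigr do rewrite mulrBr.
  by rewrite sumrB -mulr_suml w1 mul1r.
have vlast : \sum_(i < N) w i * rest (xs i) = v ord_max + tau.
  rewrite vE /tau; under [in RHS]eq_Rintegral do rewrite -restE.
  by rewrite subrK; apply: eq_bigr => i _; rewrite restE.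
have vlow : \sum_(i < N) w i * low (xs i) - \int[mu]_x low x =
    \sum_(j < d) a j * v (widen_ord (leqnSn d) j).
  rewrite ilow /low; under eq_bigr do rewrite mulr_sumr.
  rewrite exchange_big/= -sumrB; apply: eq_bigr => j _; rewrite vE mulrBr mulr_sumr.
  congr (_ - a j * _); first by apply: eq_bigr => i _; rewrite phiE; ring.
  by apply: eq_Rintegral => x _; rewrite phiE.
have Shigh : `|\sum_(i < N) w i * high (xs i)| <= b * (v ord_max + tau).
  rewrite -vlast mulr_sumr (le_trans (ler_norm_sum _ _ _))//; apply: ler_sum => i _.
  by rewrite normrM ger0_norm// mulrCA ler_wpM2l.
have Sh : \sum_(i < N) w i * h (xs i) =
    \sum_(i < N) w i * low (xs i) + \sum_(i < N) w i * high (xs i).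
  by rewrite -big_split/=; apply: eq_bigr => i _; rewrite -mulrDr /high addrC subrK.
(* The vector [(c a, b)] has squared norm [ip h h <= 1]; the signs [c = 1] and [c = -1] together
   bound the absolute value. *)
have dotv (c : R) : c ^+ 2 = 1 ->
    c * (\sum_(j < d) a j * v (widen_ord (leqnSn d) j)) + b * v ord_max <= eps.
  move=> c1; pose u (j : 'I_d.+1) := if (j < d)%N then c * a j else b.
  have um : u ord_max = b by rewrite /u/= ltnn.
  have ul (j : 'I_d) : u (widen_ord (leqnSn d) j) = c * a j by rewrite /u/= ltn_ord.
  have uv : dot u v = c * (\sum_(j < d) a j * v (widen_ord (leqnSn d) j)) + b * v ord_max.
    rewrite /dot big_ord_recr/= um [X in _ = X + _]mulr_sumr; congr (_ + _).
    by apply: eq_bigr => j _; rewrite ul mulrA.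
  have uu : dot u u <= 1 ^+ 2.
    rewrite /dot big_ord_recr/= um -expr2 b2 expr1n.
    rewrite (eq_bigr (fun j : 'I_d => a j ^+ 2)); first lra.
    by move=> j _; rewrite ul -expr2 exprMn c1 mul1r.
  by rewrite -uv -[leRHS]mul1r; apply: dot_le.
have tau0 : 0 <= tau by apply: Rintegral_ge0.
have btau : b * tau <= tau by rewrite ler_piMl.
have dp := dotv 1 (expr1n _ _).
have dn : -1 * (\sum_(j < d) a j * v (widen_ord (leqnSn d) j)) + b * v ord_max <= eps.
  by apply: dotv; rewrite sqrrN expr1n.
move: Ihigh Shigh; rewrite !ler_norml Sh Ih mulrDr => /andP[? ?] /andP[? ?].
by apply/andP; split; move: vlow dp dn; lra.
Qed.

(** Kernel combinations of norm at most 1 converge uniformly to [f]: this makes [f] measurable and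
    bounded and carries the quadrature bound over. *)
Lemma rkhs_quadrature f (N : nat) (w : 'I_N -> R) (xs : 'I_N -> X) (eps : R) :
  H f -> ip f f <= 1 -> simplex w -> 0 <= eps ->
  dot (comb w (fun i => cfeat (xs i))) (comb w (fun i => cfeat (xs i))) <= eps ^+ 2 ->
  mu.-integrable setT (EFin \o f) /\
  `|\int[mu]_x f x - \sum_(i < N) w i * f (xs i)| <= 2 * \int[mu]_x rest x + eps.
Proof.
move=> Hf f1 sw eps0 vv; have [w0 w1] := sw.
have C0 : 0 <= kap ^+ 2 by exact: sqr_ge0.
have [s hs] := choice (fun n : nat =>
  kcomb_dense hH kk C0 (ltac:(by rewrite invr_gt0) : 0 < n.+1%:R^-1 :> R) Hf).
have hs1 n : ip (kcomb k (s n)) (kcomb k (s n)) <= 1.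
  by rewrite (le_trans _ f1)//; have [] := hs n.
have mf : measurable_fun setT f.
  apply: (@measurable_fun_cvg _ _ _ _ (fun n => kcomb k (s n))).
    by move=> n; exact: measurable_kcomb.
  move=> x _; apply/cvgrPdist_le => e e0; near=> n.
  have [/(_ x) h _] := hs n; rewrite (le_trans h)// ltW//.
  by near: n; exact: near_infty_natSinv_lt (PosNum e0).
have fb x : `|f x| <= 1 + kap.
  have [/(_ x) h _] := hs 0; have := kcomb_le x (hs1 0).
  rewrite invr1 in h; have := ler_normD (f x - kcomb k (s 0) x) (kcomb k (s 0) x).
  rewrite subrK; lra.
have fi : mu.-integrable setT (EFin \o f) by exact: integrable_bounded fb.
split => //; apply/ler_addgt0Pr => e e0.
have [n ne] : exists n : nat, n.+1%:R^-1 <= e / 2.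
  have e2 : 0 < e / 2 by rewrite divr_gt0.
  have [n _ h] := near_infty_natSinv_lt (PosNum e2); exists n; apply/ltW.
  exact: (h n (leqnn n)).
have [hn _] := hs n.
set h := kcomb k (s n) in hn.
have ih : mu.-integrable setT (EFin \o h).
  apply: (integrable_bounded _ (M := kap)); first exact: measurable_kcomb.
  by move=> x; exact: kcomb_le.
have igh : mu.-integrable setT (EFin \o (fun x => f x - h x)).
  by apply: integrable_bounded hn; apply: measurable_funB => //; exact: measurable_kcomb.
have I1 : `|\int[mu]_x f x - \int[mu]_x h x| <= e / 2.
  rewrite -RintegralB// (le_trans (le_normr_Rintegral measurableT igh))//.
  rewrite -[leRHS](Rintegral_probability_cst mu); apply: le_Rintegral => //.
  - exact: integrable_norm.
  - exact: integrable_cst.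
  - by move=> x _; rewrite (le_trans (hn x)).
have I2 : `|\sum_(i < N) w i * h (xs i) - \sum_(i < N) w i * f (xs i)| <= e / 2.
  have -> : e / 2 = \sum_(i < N) w i * (e / 2) by rewrite -mulr_suml w1 mul1r.
  rewrite -sumrB (le_trans (ler_norm_sum _ _ _))//.
  apply: ler_sum => i _; rewrite -mulrBr normrM ger0_norm//.
  by apply: ler_wpM2l => //; rewrite distrC; exact: le_trans (hn _) ne.
have I3 := kcomb_quadrature (hs1 n) sw eps0 vv.
move: I1 I2 I3; rewrite -/h !ler_norml => /andP[? ?] /andP[? ?] /andP[? ?].
by apply/andP; split; lra.
Unshelve. all: by end_near.
Qed.

End mercer.

(** * The spectral tail and the final bound *)

(** Termwise integration of the squared rest gives the sum of [sigma j] over [j >= d], which bounds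
    the square of the mean. Indices start at 0, so this is the tail after the first [d]
    eigenvalues. *)
Lemma rest_mean_le (R : realType) (d1 : measure_display) (X : measurableType d1)
    (mu : probability X R) (k : X -> X -> R) (phi : nat -> X -> R) (kap : R)
    (d : nat) (sigma : nat -> R) :
  (forall j, measurable_fun setT (phi j)) ->
  (forall x y, series (fun j => phi j x * phi j y) n @[n --> \oo] --> k x y) ->
  0 <= kap -> (forall x, k x x <= kap ^+ 2) ->
  (forall j, (\int[mu]_x (phi j x * phi j x)%:E = (sigma j)%:E)%E) ->
  (forall j, 0 <= sigma j) ->
  \int[mu]_x rest k phi d x <= Num.sqrt (fine (\sum_(d <= j <oo) (sigma j)%:E)%E).
Proof.
move=> mphi mercer kap0 kk phi2 sig0; set r := rest k phi d.
have rE x : (r x ^+ 2)%:E = (\sum_(0 <= j <oo) (phi (j + d)%N x * phi (j + d)%N x)%:E)%E.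
  apply/esym/cvg_lim => //.
  rewrite (_ : (fun n => _) = EFin \o (fun n =>
      series (fun j => phi j x * phi j x) (n + d)%N - \sum_(j < d) phi j x ^+ 2)).
    apply: cvg_EFin; first by near=> n.
    rewrite /r (rest_sqr d mercer); apply: cvgB; last exact: cvg_cst.
    by rewrite (cvg_shiftn d (series (fun j => phi j x * phi j x))).
  apply: funext => n; rewrite /= sumEFin; congr (_%:E).
  rewrite /series/= (big_cat_nat (leq0n d) (leq_addl n d))/=.
  rewrite -[X in \sum_(X <= _ < n + d) _]add0n big_addn addnK.
  rewrite [X in X + _ - _]big_mkord (eq_bigr (fun j : 'I_d => phi j x ^+ 2)).
    by rewrite addrAC subrr add0r.
  by move=> j _; rewrite expr2.
have Ir2 : (\int[mu]_x (r x ^+ 2)%:E = \sum_(d <= j <oo) (sigma j)%:E)%E.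
  under eq_integral do rewrite rE.
  rewrite integral_nneseries//.
  - rewrite -(nneseries_addn d (f := fun j => (sigma j)%:E)).
      by apply: eq_eseriesr => j _; rewrite phi2.
    by move=> j; rewrite lee_fin.
  - by move=> j; apply/measurable_EFinP; exact: measurable_funM.
  - by move=> j x _; rewrite lee_fin -expr2 sqr_ge0.
have mr : measurable_fun setT r by exact: measurable_rest.
have r0 x : 0 <= r x by exact: sqrtr_ge0.
have rk x : r x <= kap.
  rewrite -ler_sqr ?nnegrE// /r (rest_sqr d mercer) (le_trans _ (kk x))// gerBl.
  by apply: sumr_ge0 => j _; exact: sqr_ge0.
have ir : mu.-integrable setT (EFin \o r).
  by apply: (integrable_bounded _ (M := kap)) => // x; rewrite ger0_norm.
have ir2 : mu.-integrable setT (EFin \o (fun x => r x ^+ 2)).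
  apply: (integrable_bounded _ (M := kap ^+ 2)); first exact: measurable_funX.
  by move=> x; rewrite ger0_norm ?sqr_ge0// ler_sqr ?nnegrE.
rewrite -Ir2 -/(Rintegral mu setT (fun x => r x ^+ 2)).
set t := \int[mu]_x r x.
have t0 : 0 <= t by apply: Rintegral_ge0.
(* Jensen's inequality for the square, from the nonnegative mean of [(r - t) ^+ 2]. *)
have : 0 <= \int[mu]_x (r x ^+ 2 - (2 * t * r x - t ^+ 2)).
  by apply: Rintegral_ge0 => x _; have := sqr_ge0 (r x - t); rewrite sqrrB; lra.
have itr : mu.-integrable setT (EFin \o (fun x => 2 * t * r x)).
  apply: (integrable_bounded _ (M := 2 * t * kap)).
    by apply: measurable_funM => //; exact: measurable_cst.
  by move=> x; rewrite ger0_norm ?mulr_ge0// ler_wpM2l// mulr_ge0.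
have itr2 : mu.-integrable setT (EFin \o (fun x => 2 * t * r x - t ^+ 2)).
  apply: (integrable_bounded _ (M := 2 * t * kap + t ^+ 2)).
    apply: measurable_funB; last exact: measurable_cst.
    by apply: measurable_funM => //; exact: measurable_cst.
  move=> x; rewrite (le_trans (ler_normB _ _))// lerD ?ger0_norm ?sqr_ge0 ?mulr_ge0//.
  by rewrite ler_wpM2l// mulr_ge0.
rewrite RintegralB// RintegralB//; last exact: integrable_cst.
rewrite RintegralZl// Rintegral_probability_cst -/t => h.
rewrite -[leLHS]ger0_norm// -sqrtr_sqr ler_sqrt; first lra.
by apply: Rintegral_ge0 => x _; exact: sqr_ge0.
Unshelve. all: by end_near.
Qed.

Theorem theorem6 (R : realType) (d1 : measure_display) (X : measurableType d1)
  (mu : probability X R) (k : X -> X -> R)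
  (H : set (X -> R)) (ip : (X -> R) -> (X -> R) -> R)
  (sigma : nat -> R) (e : nat -> X -> R)
  (hpd : pd_kernel k) (hH : is_RKHS k H ip)
  (hkappa : has_ubound (range (fun x => Num.sqrt (k x x))))
  (hmercer : forall x y,
      series (fun j => sigma j * e j x * e j y) n @[n --> \oo] --> k x y)
  (hortho : orthonormal_L2 mu e)
  (hsig_nonneg : forall j, 0 <= sigma j)
  (hsig_noninc : forall j, sigma j.+1 <= sigma j)
  (N d : nat) (hd : (0 < d)%N) (hN : (0 < N)%N) (hNd : (6 * (d + 1) <= N)%N)
  (d0 : measure_display) (Omega : measurableType d0) (P : probability Omega R)
  (Xs : 'I_N -> Omega -> X)
  (hXmeas : forall i, measurable_fun setT (Xs i))
  (hXdist : forall i (A : set X), measurable A -> P (Xs i @^-1` A) = mu A)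
  (hXindep : mutually_independent P Xs) :
  let kappa := sup (range (fun x => Num.sqrt (k x x))) in
  let n_d := (N %/ (6 * (d + 1)))%N in
  let tail := fine (\sum_(d <= j <oo) (sigma j)%:E)%E in
  exists E : set Omega, measurable E /\
    (P E >= (1 - 2 ^- (d + 1))%:E)%E /\
    forall omega, E omega ->
      exists w : 'I_N -> R, simplex w /\
        (wce mu H ip w (fun i => Xs i omega)
          <= (2 * Num.sqrt tail + 4 * kappa / n_d%:R)%:E)%E.
Proof.
move=> kappa n_d tail; have [me oe] := hortho.
(* Absorbing the root of [sigma j] makes the kernel a plain sum of products [phi j x * phi j y]. *)
pose phi j x := Num.sqrt (sigma j) * e j x.
have phiE j x y : phi j x * phi j y = sigma j * e j x * e j y.
  by rewrite /phi mulrACA -expr2 sqr_sqrtr// mulrA.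
have mphi j : measurable_fun setT (phi j).
  by apply: measurable_funM => //; exact: measurable_cst.
have mercer x y : series (fun j => phi j x * phi j y) n @[n --> \oo] --> k x y.
  by under eq_fun do under eq_fun do rewrite phiE; exact: hmercer.
have sk x : Num.sqrt (k x x) <= kappa by apply: ub_le_sup => //; exists x.
(* [point] is an element of [X], so [kappa] dominates at least one square root. *)
have kap0 : 0 <= kappa by rewrite (le_trans _ (sk point))// sqrtr_ge0.
have kxx0 x : 0 <= k x x.
  by have [] := tail_cauchy_schwarz 0 (mercer x x) (mercer x x) (mercer x x);
    rewrite big_ord0 subr0.
have kk x : k x x <= kappa ^+ 2 by rewrite -(sqr_sqrtr (kxx0 x)) ler_sqr ?nnegrE ?sqrtr_ge0.
have phi2 j : (\int[mu]_x (phi j x * phi j x)%:E = (sigma j)%:E)%E.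
  under eq_integral do rewrite phiE -mulrA EFinM.
  rewrite ge0_integralZl_EFin//.
  - by rewrite oe eqxx mule1.
  - by move=> x _; rewrite lee_fin -expr2 sqr_ge0.
  - by apply/measurable_EFinP; exact: measurable_funM.
have n0 : (0 < n_d)%N by rewrite divn_gt0// muln_gt0 addn1.
have DnN : (6 * d.+1 * n_d <= N)%N by rewrite mulnC /n_d addn1 leq_trunc_div.
have K0 : 0 <= 2 * kappa by rewrite mulr_ge0.
have mf (j : 'I_d.+1) : measurable_fun setT ((@cfeat _ _ _ mu k phi d)^~ j).
  exact: measurable_cfeat.
have fK x : dot (@cfeat _ _ _ mu k phi d x) (cfeat mu k phi x) <= (2 * kappa) ^+ 2.
  exact: dot_cfeat.
have f0 (j : 'I_d.+1) : \int[mu]_x cfeat mu k phi x j = 0 by exact: cfeat_mean0 kk _.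
(* The dimension is [d.+1], at least 2 because [d] is positive; the radius [2 * kappa] yields the
   error [4 * kappa / n_d]. *)
have [E [mE PE hE]] :=
  random_hull hXmeas hXdist hXindep (hd : (1 < d.+1)%N) n0 DnN K0 mf fK f0.
exists E; split=> //; split; first by rewrite addn1.
move=> omega /hE[w sw ww]; exists w; split=> //.
have eps0 : 0 <= 2 * (2 * kappa) / n_d%:R by rewrite divr_ge0 ?mulr_ge0.
apply: ge_ereal_sup => _ [f [Hf f1] <-].
have [fi fq] := rkhs_quadrature hH mphi mercer kap0 kk Hf f1 sw eps0 ww.
rewrite integral_Rintegral// -EFinB abse_EFin lee_fin (le_trans fq)//.
have -> : 2 * (2 * kappa) / n_d%:R = 4 * kappa / n_d%:R by ring.
rewrite lerD2r ler_wpM2l//.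
exact: (rest_mean_le d mphi mercer kap0 kk phi2 hsig_nonneg).
Qed.
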